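(* For each integer $n\ge 1$ let $\mathbb{P}_n^{*}$ be a probability distribution on $[n]=\{1,\ldots,n\}$, written as $\mathbb{P}_n^{*}(i)=\frac{1}{n}+\varepsilon_{i,n}$ for $i\in[n]$ (so $\sum_{i=1}^n\varepsilon_{i,n}=0$ and $\varepsilon_{i,n}\in[-\tfrac1n,1-\tfrac1n]$). Write $\alpha_n=n^{1/\log\log n}$. Assume: (i) for every $k\ge 1$ and every $k$-tuple $(p_1,\ldots,p_k)$ of distinct primes, $$\lim_{n\to\infty}\sum_{l=1}^{\lfloor n/(p_1\cdots p_k)\rfloor}\varepsilon_{lp_1\cdots p_k,n}=0;$$ (ii) there is a constant $C$ such that for all $n$ (with $\log\log n>0$) and all primes $p>\alpha_n$, $$\sum_{l=1}^{\lfloor n/p\rfloor}\varepsilon_{lp,n}\le \frac{C}{p};$$ (iii) there is a constant $D$ such that for all $n$ (with $\log\log n>0$), all $k\ge1$ and all $k$-tuples $(p_1,\ldots,p_k)$ of distinct primes each at most $\alpha_n$, $$0\le \sum_{l=1}^{\lfloor n/(p_1\cdots p_k)\rfloor}\varepsilon_{lp_1\cdots p_k,n}\le \frac{D}{n}.$$ Then for every real $x$, as $n\to\infty$, $$\mathbb{P}_n^{*}\left(\{m\le n:\ \omega(m)-\log\log n\le x(\log\log n)^{1/2}\}\right)\to \mathbb{P}(Z\le x),$$ where $Z\sim\mathcal{N}(0,1)$.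
   Context: $\omega(m)$ denotes the number of distinct prime factors of the positive integer $m$; $\lfloor\cdot\rfloor$ is the floor function; $\log$ is the natural logarithm. *)

(* Defs.v *)
From HB Require Import structures.
From mathcomp Require Import all_boot all_order all_algebra.
From mathcomp Require Import all_classical all_reals all_analysis.
Set Implicit Arguments. Unset Strict Implicit. Unset Printing Implicit Defensive.
Import Order.TTheory GRing.Theory Num.Theory.
Local Open Scope ring_scope.

Definition omega (m : nat) : nat := size (primes m).

Section defs.
Variable R : realType.

Definition eps (P : nat -> nat -> R) (n i : nat) : R := P n i - (n%:R)^-1.

Definition is_distrib_on (P : nat -> nat -> R) (n : nat) : Prop :=
  (forall i, (1 <= i <= n)%N -> 0 <= P n i) /\ \sum_(1 <= i < n.+1) P n i = 1.

Definition Ssum (P : nat -> nat -> R) (n d : nat) : R :=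
  \sum_(1 <= l < (n %/ d).+1) eps P n (l * d).

Definition alpha (n : nat) : R := (n%:R) `^ (ln (ln (n%:R : R)))^-1.

Definition distinct_primes (s : seq nat) : bool :=
  [&& s != [::], uniq s & all prime s].

Definition prob_event (P : nat -> nat -> R) (x : R) (n : nat) : R :=
  \sum_(1 <= m < n.+1 |
        (omega m)%:R - ln (ln (n%:R : R)) <= x * Num.sqrt (ln (ln (n%:R : R))))
     P n m.
End defs.

(* Main.v *)
Require Import Defs.
From HB Require Import structures.
From mathcomp Require Import all_boot all_order all_algebra.
From mathcomp Require Import all_classical all_reals all_analysis.
From mathcomp Require Import measurable_realfun ring lra zify.
Set Implicit Arguments.
Unset Strict Implicit.
Unset Printing Implicit Defensive.
Import Order.TTheory GRing.Theory Num.Theory.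
Import numFieldNormedType.Exports.
Local Open Scope classical_set_scope.
Local Open Scope ring_scope.

(** Write [E_n] for the expectation under [P n], [L = ln ln n], [S] for the number of primes
    [p <= alpha n] dividing the random integer and [mu] for the sum of their reciprocals.
    By Mertens' second theorem [mu = L + O(ln L)], and the primes above [alpha n] contribute
    only [O(ln L) = o(sqrt L)] divisors on average by (ii); so it is enough to treat
    [V = (S - mu) / sqrt L].

    By (iii) the divisibility indicators [X_p] satisfy [E_n (X_p1 ... X_pk) = 1/(p1 ... pk) + O(1/n)].
    Decoupling [X_p] from the other indicators in [E_n ((X_p - 1/p) (S - mu)^r)] gives the recursion
    [E_n V^(r+1) = r E_n V^(r-1) + o(1)] of the moments of the normal law.

    The moments control [cos (t V)] and [sin (t V)] through their Taylor polynomials, hence every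
    polynomial in [sin (b V)]; such polynomials approximate the indicators of half-lines up to
    [e + e V^2].  The normal law enters as the limit of its restrictions to [[-n, n]]. *)

(** * Mertens' second theorem *)

(** The cutoff [alpha n = n ^ (1 / L)] balances two demands. A moment of order [r] expands into
    about [alpha n ^ r] products of indicators, each with an error [O(1/n)], and every fixed power
    of [alpha n] is [o(n)]. On the other hand [ln ln (alpha n) = L - ln L], so discarding the larger
    primes costs only [O(ln L)], which is negligible against the standard deviation [sqrt L].

    No independent model of the indicators is introduced: the recursion runs on the given weights,
    in the manner of Stein. Its Taylor error involves absolute moments; these are bounded by an even
    moment of order at most [r], which a strong induction has already controlled.

    The moments suffice because the mean Taylor remainder of [cos (t V)] of order [2 k] tends to
    [(t^2 / 2)^k / k!], which is small for large [k]. A polynomial in [sin (b V)] resembles a step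
    on one period only, but it stays within [[0, 1]], so the term [e V^2] absorbs the rest of the
    line. *)

Lemma prime_prod_dvdn (s : seq nat) (d : nat) :
  uniq s -> all prime s -> (\prod_(p <- s) p %| d)%N = all (fun p => p %| d)%N s.
Proof.
elim: s => [|p s IH] /=; first by rewrite big_nil dvd1n.
move=> /andP[pNs us] /andP[pp ps]; rewrite big_cons Gauss_dvd ?IH//.
rewrite coprime_sym big_seq; apply: (big_ind (fun x => coprime x p)) => //.
- by rewrite /coprime gcd1n.
- by move=> x y cx cy; rewrite coprimeMl cx.
- move=> q qs; rewrite prime_coprime ?(allP ps)// dvdn_prime2 ?(allP ps q)//.
  by apply/eqP => qp; rewrite -qp qs in pNs.
Qed.

Lemma prime_bin_central_dvdn (m p : nat) :
  prime p -> (m.+1 < p <= m.*2.+1)%N -> (p %| 'C(m.*2.+1, m))%N.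
Proof.
move=> pp /andP[mp pm].
have : (p %| (m.*2.+1)`!)%N by rewrite dvdn_fact// prime_gt0.
have le_m : (m <= m.*2.+1)%N by lia.
rewrite -(bin_fact le_m) !Euclid_dvdM// => /orP[//|].
have pf k : (k < p)%N -> ~~ (p %| k`!)%N.
  elim: k => [|k IH] kp; first by rewrite fact0 Euclid_dvd1.
  by rewrite factS Euclid_dvdM// negb_or IH 1?ltnW// gtnNdvd.
by move=> /orP[]; apply: contraLR => _; apply: pf; lia.
Qed.

(** The two middle coefficients of row [2 m + 1] are equal, and together they are at most
    [2 ^ (2 m + 1)]. *)
Lemma bin_central_le (m : nat) : ('C(m.*2.+1, m) <= 4 ^ m)%N.
Proof.
have := Pascal 1 1 m.*2.+1.
under eq_bigr do rewrite !exp1n !muln1.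
have lt1 : (m < m.*2.+2)%N by lia.
have lt2 : (m.+1 < m.*2.+2)%N by lia.
rewrite (bigD1 (Ordinal lt1))//= (bigD1 (Ordinal lt2))/=; last first.
  by apply/eqP => /(congr1 val) /=; lia.
rewrite addnA -(bin_sub (ltnSE lt1)).
have -> : (m.*2.+1 - m = m.+1)%N by lia.
set T := (\sum_(_ < _ | _) _)%N; move: T => T.
have -> : ((1 + 1) ^ m.*2.+1 = 2 * 4 ^ m)%N by rewrite addn1 expnS -mul2n expnM.
lia.
Qed.

(** Erdős's induction. An even [n > 2] is not prime. For [n = 2 m + 1] the primes up to [m + 1] fall
    under the induction hypothesis, and the product of the remaining ones divides a middle binomial
    coefficient, at most [4 ^ m]. *)
Lemma primorial_le (n : nat) :
  (\prod_(0 <= p < n.+1 | prime p) p <= 4 ^ n)%N.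
Proof.
elim/ltn_ind: n => n IH.
have [n2|n2] := leqP n 2.
  by case: n n2 {IH} => [|[|[|//]]] _; rewrite unlock.
have [on|en] := boolP (odd n); last first.
  rewrite big_mkcond big_nat_recr//= -big_mkcond/=.
  rewrite ifF; last first.
    by apply: contraNF en => /even_prime[] // n_2; lia.
  rewrite muln1; have -> : n = n.-1.+1 by lia.
  by apply: (leq_trans (IH n.-1 _)); [lia | rewrite leq_exp2l//; lia].
pose m := n./2.
have nE : n = m.*2.+1 by rewrite /m -[LHS]odd_double_half on.
have m1 : (1 <= m)%N by lia.
rewrite (big_cat_nat (n := m.+2))//=; last by lia.
apply: (@leq_trans (4 ^ m.+1 * 4 ^ m)); last first.
  by rewrite -expnD leq_exp2l//; lia.
apply: leq_mul; first by apply: IH; lia.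
apply: leq_trans (bin_central_le m); apply: dvdn_leq; first by rewrite bin_gt0; lia.
rewrite -big_filter prime_prod_dvdn ?filter_uniq ?iota_uniq//.
  apply/allP => p; rewrite mem_filter mem_index_iota => /andP[pp pi].
  by apply: prime_bin_central_dvdn => //; lia.
by apply/allP => p; rewrite mem_filter => /andP[].
Qed.

Section Mertens.
Variable R : realType.
Local Notation ln := (@ln R).

Lemma ln_le_sub1 (x : R) : 0 < x -> ln x <= x - 1.
Proof.
by move=> x0; rewrite -{1}(subrK 1 x) [_ - 1 + 1]addrC le_ln1Dx//; lra.
Qed.

Lemma ln_succ_sub (n : nat) : (0 < n)%N ->
  ln n.+1%:R - ln n%:R <= n%:R^-1.
Proof.
move=> n0; have n0' : 0 < n%:R :> R by rewrite ltr0n.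
rewrite -ln_div ?posrE// ?ltr0n//.
apply: (le_trans (ln_le_sub1 _)); first by rewrite divr_gt0// ltr0n.
by rewrite -natr1 mulrDl divff ?gt_eqF// mul1r addrAC subrr add0r.
Qed.

Lemma ln_fact_ge (n : nat) : (0 < n)%N ->
  n%:R * ln n%:R - n%:R <= ln (n`!%:R).
Proof.
elim: n => // -[_ _|n IH _]; first by rewrite factS fact0 muln1 ln1; lra.
rewrite factS natrM lnM ?posrE ?ltr0n ?fact_gt0//.
have := IH isT; have := ln_succ_sub (ltn0Sn n).
set a := ln _; set b := ln _; set c := ln _ => h1 h2.
have : n.+1%:R * (a - b) <= 1 :> R.
  by rewrite -[leRHS](@mulfV _ n.+1%:R) ?pnatr_eq0// ler_wpM2l.
rewrite -(natr1 n.+1); lra.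
Qed.

Lemma ln_fact_le (n : nat) : ln (n`!%:R) <= n%:R * ln n%:R.
Proof.
elim: n => [|n IH]; first by rewrite fact0 ln1 mul0r.
rewrite factS natrM lnM ?posrE ?ltr0n ?fact_gt0// -[X in _ <= X * _]natr1 mulrDl mul1r addrC.
rewrite lerD2r (le_trans IH)// ler_wpM2l//.
case: n {IH} => [|n]; first by rewrite ln0// ln1.
by rewrite ler_ln ?posrE ?ltr0n// ler_nat.
Qed.

Lemma ln_prod (I : Type) (r : seq I) (Q : pred I) (f : I -> nat) :
  (forall i, Q i -> (0 < f i)%N) ->
  ln ((\prod_(i <- r | Q i) f i)%N%:R) = \sum_(i <- r | Q i) ln (f i)%:R.
Proof.
move=> f0; pose K (x : nat) (y : R) := (0 < x)%N /\ ln x%:R = y.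
suff [] : K (\prod_(i <- r | Q i) f i)%N (\sum_(i <- r | Q i) ln (f i)%:R) by [].
apply: big_ind2 => //; first by rewrite /K ln1.
- move=> x1 y1 x2 y2 [p1 <-] [p2 <-]; split; first by rewrite muln_gt0 p1.
  by rewrite natrM lnM ?posrE ?ltr0n.
- by move=> i Qi; split => //; exact: f0.
Qed.

(** Chebyshev's bound for the theta function. *)
Lemma sum_ln_prime_le (n : nat) :
  \sum_(0 <= p < n.+1 | prime p) ln p%:R <= n%:R * ln 4.
Proof.
rewrite -ln_prod; last by move=> p; exact: prime_gt0.
rewrite mulr_natl -lnXn// -natrX ler_ln ?posrE ?ltr0n ?expn_gt0//.
  by rewrite ler_nat primorial_le.
by apply: prodn_cond_gt0 => p; exact: prime_gt0.
Qed.

Lemma ln_fact_primes (n : nat) :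
  ln n`!%:R = \sum_(0 <= p < n.+1 | prime p) (logn p n`!)%:R * ln p%:R.
Proof.
have eqf : n`! = (\prod_(0 <= p < n.+1 | prime p) p ^ logn p n`!)%N.
  (* The factorization given by [partnT] ranges over primes up to the factorial itself; those above
     [n] have exponent 0 and are split off. *)
  have nf : (n.+1 <= n`!.+1)%N by rewrite ltnS; case: n => // n; rewrite factS leq_pmulr// fact_gt0.
  rewrite -{1}(partnT (fact_gt0 n)) /partn (big_cat_nat (n := n.+1))//= [X in (_ * X)%N]big1_seq ?muln1.
    rewrite /partn [RHS]big_mkcond; apply: eq_bigr => p _; case: ifPn => // pN.
    by rewrite lognE (negbTE pN).
  move=> p /andP[_]; rewrite mem_index_iota => /andP[np _].
  have [pp|pN] := boolP (prime p); last by rewrite lognE (negbTE pN).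
  rewrite logn_fact// big1_seq// => k /andP[_]; rewrite mem_index_iota => /andP[k0 _].
  by rewrite divn_small// (leq_trans np)// -{1}(expn1 p) leq_exp2l ?prime_gt1.
rewrite {1}eqf ln_prod; last by move=> p pp; rewrite expn_gt0 prime_gt0.
by apply: eq_bigr => p pp; rewrite natrX lnXn ?ltr0n ?prime_gt0// mulr_natl.
Qed.

(** In Legendre's formula the first term alone gives the lower bound, and the full geometric series
    gives the upper one. *)
Lemma logn_fact_bounds (n p : nat) : prime p ->
  n%:R / p%:R - 1 <= (logn p n`!)%:R :> R /\ (logn p n`!)%:R <= n%:R / (p%:R - 1) :> R.
Proof.
move=> pp; have p1 := prime_gt1 pp; have p0 := prime_gt0 pp.
have p0' : 0 < p%:R :> R by rewrite ltr0n.
have p1' : 1 < p%:R :> R by rewrite ltr1n.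
rewrite logn_fact//; split.
  case: n => [|n]; first by rewrite mul0r big_nil; lra.
  rewrite big_nat_recl//= expn1 natrD.
  apply: (@le_trans _ _ ((n.+1 %/ p)%N%:R)); last by rewrite lerDl.
  rewrite lerBlDr ler_pdivrMr// -[X in _ + X]/(1%:R) -natrD -natrM ler_nat.
  by rewrite addn1 ltnW// ltn_ceil.
(* Keeping the remainder [n / p ^ k] of the geometric series makes the induction close. *)
suff H k : (\sum_(1 <= i < k.+1) n %/ p ^ i)%N%:R * (p%:R - 1) <= n%:R - n%:R / p%:R ^+ k :> R.
  rewrite ler_pdivlMr ?subr_gt0//; apply: (le_trans (H n)).
  by rewrite lerBlDr lerDl divr_ge0// exprn_ge0// ltW.
elim: k => [|k IH]; first by rewrite big_nil mul0r expr0 divr1 subrr.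
rewrite big_nat_recr//= natrD mulrDl; apply: (le_trans (lerD IH (le_refl _))).
have h : (n %/ p ^ k.+1)%N%:R <= n%:R / p%:R ^+ k.+1 :> R.
  by rewrite ler_pdivlMr ?exprn_gt0// -natrX -natrM ler_nat leq_divM.
have -> : n%:R / p%:R ^+ k = (n%:R / p%:R ^+ k.+1) * p%:R :> R.
  by rewrite exprSr invfM -!mulrA mulVf ?gt_eqF// mulr1.
have := ler_wpM2r (_ : 0 <= p%:R - 1 :> R) h; rewrite subr_ge0 ltW// => /(_ isT).
lra.
Qed.

(* [(ln n + 3) / n] telescopes to a majorant of the summand. *)
Lemma sum_ln_div_sqr_le (n : nat) : (1 <= n)%N ->
  \sum_(2 <= k < n.+1) ln k%:R / (k%:R * (k%:R - 1)) <= 3 - (ln n%:R + 3) / n%:R.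
Proof.
elim: n => // -[_ _|n IH _]; first by rewrite big_geq// ln1; lra.
rewrite big_nat_recr//=; apply: (le_trans (lerD (IH isT) (le_refl _))).
have := ln_succ_sub (ltn0Sn n); rewrite -(natr1 n.+1).
set x : R := n.+1%:R; have x1 : 1 <= x by rewrite ler1n.
set a := ln _; set b := ln x => hab.
have -> : x + 1 - 1 = x by ring.
suff : (a + (a + 3) * x) / ((x + 1) * x) <= ((b + 3) * (x + 1)) / ((x + 1) * x).
  have -> : (a + (a + 3) * x) / ((x + 1) * x) = a / ((x + 1) * x) + (a + 3) / (x + 1).
    by field; apply/andP; split; lra.
  have -> : ((b + 3) * (x + 1)) / ((x + 1) * x) = (b + 3) / x by field; apply/andP; split; lra.
  by move: (a / _) (_ / (x + 1)) (_ / x) => u v w; lra.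
rewrite ler_pM2r ?invr_gt0; last by nra.
have : (a - b) * x <= 1.
  by rewrite -[leRHS](@mulVf _ x) ?ler_wpM2r//; lra.
nra.
Qed.

Definition prime_ln_sum (n : nat) : R :=
  \sum_(0 <= p < n.+1 | prime p) ln p%:R / p%:R.

(** The logarithm of the factorial is [n ln n + O(n)], and it is also a sum over primes with
    Legendre exponents between [n / p - 1] and [n / (p - 1)]. The first exponent bound loses theta,
    hence [ln 4 <= 3] after division by [n]. The second loses the sum of [ln p / (p (p - 1))], at
    most 3, to which the factorial estimate adds 1. *)
Lemma mertens_first (n : nat) : (1 <= n)%N ->
  `|prime_ln_sum n - ln n%:R| <= 4.
Proof.
move=> n1; have n0 : 0 < n%:R :> R by rewrite ltr0n.
have lnp p : prime p -> 0 <= ln p%:R.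
  by move=> pp; rewrite ln_ge0// ler1n prime_gt0.
have up : n%:R * prime_ln_sum n - n%:R * ln 4 <= n%:R * ln n%:R.
  apply: le_trans (ln_fact_le n); rewrite ln_fact_primes.
  apply: le_trans (lerB (le_refl _) (sum_ln_prime_le n)) _.
  rewrite mulr_sumr -sumrB ler_sum// => p pp.
  have [+ _] := logn_fact_bounds n pp; move=> /(ler_wpM2r (lnp p pp)).
  by rewrite mulrBl mul1r [ln _ / _]mulrC mulrA.
have lo : n%:R * ln n%:R - n%:R <= n%:R * prime_ln_sum n + n%:R * 3.
  apply: (le_trans (ln_fact_ge n1)); rewrite ln_fact_primes.
  apply: (@le_trans _ _ (n%:R * prime_ln_sum n + n%:R *
      \sum_(0 <= p < n.+1 | prime p) ln p%:R / (p%:R * (p%:R - 1)))).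
    rewrite !mulr_sumr -big_split/= ler_sum// => p pp.
    have p1' : 1 < p%:R :> R by rewrite ltr1n prime_gt1.
    have [_ +] := logn_fact_bounds n pp; move=> /(ler_wpM2r (lnp p pp)) /le_trans; apply.
    by rewrite le_eqVlt; apply/orP; left; apply/eqP; field; apply/andP; split; lra.
  rewrite lerD2l ler_pM2l//.
  case: n n1 n0 {up} => // n _ n0.
  apply: (@le_trans _ _ (3 - (ln n.+1%:R + 3) / n.+1%:R)); last first.
    by rewrite lerBlDr lerDl divr_ge0// addr_ge0// ln_ge0// ler1n.
  apply: le_trans (sum_ln_div_sqr_le _) => //.
  rewrite big_ltn_cond//= big_ltn_cond//= big_mkcond/= ler_sum_nat// => k /andP[k2 _].
  case: ifP => // _; apply: divr_ge0; first by rewrite ln_ge0// ler1n ltnW.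
  by rewrite mulr_ge0// subr_ge0 ler1n ltnW.
have l4 : ln 4 <= 3 by have := ln_le_sub1 (_ : 0 < 4 :> R); lra.
rewrite ler_norml; apply/andP; split; rewrite -(ler_pM2l n0); nra.
Qed.

Definition prime_recip_sum (n : nat) : R :=
  \sum_(0 <= p < n.+1 | prime p) (p%:R)^-1.

(** Summation by parts on the first theorem, run as an induction on [n]. From [m] to [m + 1] a new
    prime contributes equally to the reciprocal sum and to [prime_ln_sum / ln], so its terms cancel.
    Since [prime_ln_sum m] is within 4 of [ln m], what remains is controlled by telescoping
    differences of [1 / ln m] and [1 / m]. *)
Lemma mertens_second : exists C : R, forall n : nat, (2 <= n)%N ->
  `|prime_recip_sum n - ln (ln n%:R)| <= C.
Proof.
have l2 : 0 < ln 2 :> R by rewrite ln_gt0 ?ltr1n.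
pose c := (ln 2 : R)^-1; have c0 : 0 < c by rewrite invr_gt0.
have main n : (2 <= n)%N ->
    - (`|ln (ln 2)| + 6 * c + 2) - 4 * (c - (ln n%:R)^-1) - 2 * c ^+ 2 * (1 - n%:R^-1)
      <= prime_recip_sum n - prime_ln_sum n / ln n%:R - ln (ln n%:R)
      <= (`|ln (ln 2)| + 6 * c + 2) + 4 * (c - (ln n%:R)^-1).
  elim: n => // -[|[_ _|n IH _]]//.
    have -> : prime_recip_sum 2 = 2^-1.
      by rewrite /prime_recip_sum unlock/= addr0.
    have -> : prime_ln_sum 2 = ln 2 / 2.
      by rewrite /prime_ln_sum unlock/= addr0.
    have -> : ln 2 / 2 / ln 2 = 2^-1 :> R by field; rewrite gt_eqF.
    rewrite -/c subrr.
    have := ler_norm (ln (ln 2)); have := ler_norm (- ln (ln 2)); rewrite normrN.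
    have : 0 <= c ^+ 2 by rewrite sqr_ge0.
    by move: (c ^+ 2) => c2; lra.
  have {IH} := IH isT.
  set m := n.+2.
  have m0 : 0 < m%:R :> R by rewrite ltr0n.
  have -> : prime_recip_sum m.+1 = prime_recip_sum m + (if prime m.+1 then (m.+1%:R)^-1 else 0).
    by rewrite /prime_recip_sum big_mkcond big_nat_recr//= -big_mkcond.
  have eA : prime_ln_sum m.+1 =
     prime_ln_sum m + ln m.+1%:R * (if prime m.+1 then (m.+1%:R)^-1 else 0).
    rewrite /prime_ln_sum big_mkcond big_nat_recr//= -big_mkcond/=.
    by case: ifP; rewrite ?mulr0.
  have := mertens_first (isT : (1 <= m)%N); rewrite ler_norml eA {eA}.
  set e := (if _ then _ else _).
  have := ln_succ_sub (isT : (0 < m)%N).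
  have : ln m%:R <= ln m.+1%:R :> R by rewrite ler_ln ?posrE ?ltr0n// ler_nat.
  have : ln 2 <= ln m%:R :> R by rewrite ler_ln ?posrE ?ltr0n// ler_nat.
  set a := ln m%:R; set b := ln m.+1%:R => h2a hab hba.
  set A := prime_ln_sum m; set M := prime_recip_sum m => /andP[A1 A2].
  have a0 : 0 < a by lra.
  have b0 : 0 < b by lra.
  have h1 : ln b - ln a <= (b - a) / a.
    rewrite -ln_div ?posrE//; apply: (le_trans (ln_le_sub1 _)); first by rewrite divr_gt0.
    by rewrite mulrBl divff ?gt_eqF.
  have h2 : (b - a) / b <= ln b - ln a.
    rewrite -[leRHS]opprB -(ln_div (x := a) (y := b)) ?posrE// lerNr; apply: (le_trans (ln_le_sub1 _)); first by rewrite divr_gt0.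
    by rewrite mulrBl divff ?gt_eqF// opprB.
  (* The gap between the upper and lower estimates of [ln b - ln a] is at most [c ^+ 2 / m ^ 2], and
     [1 / m ^ 2 <= 2 / (m (m + 1))] makes it telescope. *)
  have h3 : (b - a) / a - (b - a) / b <= 2 * c ^+ 2 * (m%:R^-1 - m.+1%:R^-1).
    have -> : (b - a) / a - (b - a) / b = (b - a) ^+ 2 * (a^-1 * b^-1).
      by field; apply/andP; split; lra.
    apply: (@le_trans _ _ (m%:R^-1 ^+ 2 * (c * c))).
      apply: ler_pM; rewrite ?sqr_ge0//.
      - by rewrite mulr_ge0// invr_ge0 ltW.
      - by rewrite ler_pXn2r ?nnegrE ?subr_ge0// invr_ge0.
      - by apply: ler_pM; rewrite ?invr_ge0 ?lef_pV2 ?posrE//; lra.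
    have -> : 2 * c ^+ 2 * (m%:R^-1 - m.+1%:R^-1) = 2 * (m%:R^-1 - m.+1%:R^-1) * (c * c).
      by rewrite expr2; move: (_^-1) (_^-1) => u v; ring.
    rewrite ler_wpM2r ?mulr_ge0 ?(ltW c0)// -(natr1 m).
    have m1 : 1 <= m%:R :> R by rewrite ler1n.
    have -> : 2 * (m%:R^-1 - (m%:R + 1)^-1) = m%:R^-1 * (2 * (m%:R + 1)^-1) :> R.
      by field; apply/andP; split; lra.
    rewrite expr2 ler_pM2l ?invr_gt0// ler_pdivlMr; last by lra.
    rewrite mulrDr mulVf ?gt_eqF// mulr1.
    by have : m%:R^-1 <= 1 :> R; [rewrite invf_le1|lra].
  have h4 : (A + b * e) / b = e + A / b by field; lra.
  have h5 : (b - a) / b = a * (a^-1 - b^-1) by field; apply/andP; split; lra.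
  have h6 : b^-1 <= a^-1 by rewrite lef_pV2.
  have h7 : (A - a) * (a^-1 - b^-1) <= 4 * (a^-1 - b^-1) by rewrite ler_wpM2r; lra.
  have h8 : - 4 * (a^-1 - b^-1) <= (A - a) * (a^-1 - b^-1) by rewrite ler_wpM2r; lra.
  have h9 : (A - a) * (a^-1 - b^-1) = A / a - A / b - (b - a) / b.
    by rewrite h5; move: (_^-1) (_^-1) => u v; ring.
  have step (k d N Xa Xb la lb u v Q0 Q1 t w z : R) :
      lb - la <= Q0 -> Q1 <= lb - la -> Q0 - Q1 <= t * w - t * z ->
      Xa - Xb - Q1 <= 4 * (u - v) -> -4 * (u - v) <= Xa - Xb - Q1 ->
      - k - 4 * (d - u) - (t - t * w) <= N - Xa - la <= k + 4 * (d - u) ->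
      - k - 4 * (d - v) - (t - t * z) <= N - Xb - lb <= k + 4 * (d - v).
    move: (t * w) (t * z) => tw tz g1 g2 g3 g4 g5 /andP[g6 g7].
    by apply/andP; split; lra.
  move: h3 h7 h8; rewrite h4 h9 !(mulrBr (2 * c ^+ 2)) mulr1 => h3 h7 h8 IH.
  rewrite addrKA.
  exact: (step _ _ _ _ _ _ _ _ _ _ _ _ _ _ h1 h2 h3 h7 h8 IH).
exists ((`|ln (ln 2)| + 6 * c + 2) + 4 * c + 2 * c ^+ 2 + 1 + 4 * c) => n n2.
have /andP[] := main n n2.
have := mertens_first (ltnW n2); rewrite ler_norml => /andP[].
have : ln 2 <= ln n%:R :> R by rewrite ler_ln ?posrE ?ltr0n ?(ltnW n2)// ler_nat.
set a := ln n%:R; set A := prime_ln_sum n => h2a A1 A2.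
have a0 : 0 < a by lra.
have h6 : a^-1 <= c by rewrite lef_pV2.
have h7 : 0 <= a^-1 by rewrite invr_ge0 ltW.
have h3 : A / a <= 1 + 4 * c.
  by rewrite ler_pdivrMr// mulrDl -mulrA; have := ler_wpM2l (ltW c0) h2a; rewrite mulVf ?gt_eqF//; lra.
have h4 : 1 - 4 * c <= A / a.
  by rewrite ler_pdivlMr// mulrBl -mulrA; have := ler_wpM2l (ltW c0) h2a; rewrite mulVf ?gt_eqF//; lra.
have h5 : 0 <= c ^+ 2 * n%:R^-1 by rewrite mulr_ge0 ?sqr_ge0// invr_ge0.
rewrite ler_norml => H1 H2; apply/andP; split; nra.
Qed.
End Mertens.

(** * Functionals with gaussian moments *)

Section TrigTaylor.
Variable R : realType.

Lemma le_of_derive_le (f g df dg : R -> R) (y : R) : 0 <= y ->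
  (forall x, is_derive x (1 : R) f (df x)) ->
  (forall x, is_derive x (1 : R) g (dg x)) ->
  f 0 = g 0 -> (forall x, 0 <= x -> df x <= dg x) -> f y <= g y.
Proof.
move=> y0 f' g' fg0 dfg; have [->|yN0] := eqVneq y 0; first by rewrite fg0.
have y_gt0 : 0 < y by rewrite lt_def yN0.
have d x : is_derive x (1 : R) (g - f) (dg x - df x) by exact: is_deriveB.
have cont : {within `[0, y], continuous (g - f)}%classic.
  apply: continuous_subspaceT => x.
  by apply: differentiable_continuous; apply/derivable1_diffP; have [] := d x.
have [c] := MVT y_gt0 (fun x _ => d x) cont.
rewrite in_itv/= => /andP[c0 cy] /eqP.
rewrite !fctE fg0 subrr subr0 subr0 => /eqP e.
by rewrite -subr_ge0 e mulr_ge0// subr_ge0 dfg// ltW.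
Qed.

Definition cos_taylor (k : nat) (y : R) : R :=
  \sum_(i < k) (-1) ^+ i * y ^+ i.*2 / (i.*2)`!%:R.

Definition sin_taylor (k : nat) (y : R) : R :=
  \sum_(i < k) (-1) ^+ i * y ^+ i.*2.+1 / (i.*2.+1)`!%:R.

Lemma is_derive_pow_fact (n : nat) (x c : R) :
  is_derive x (1 : R) (fun y => c * y ^+ n.+1 / n.+1`!%:R) (c * x ^+ n / n`!%:R).
Proof.
have := @is_deriveX _ _ (@id R) n.+1 x 1 1 (is_derive_id x 1).
move=> /(@is_deriveZ _ _ _ _ (c / n.+1`!%:R)).
have -> : (c / (n.+1)`!%:R) \*: ((@id R) ^+ n.+1) = (fun y => c * y ^+ n.+1 / n.+1`!%:R).
  by apply/funext => y /=; rewrite !fctE /=; rewrite mulrAC.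
move=> h; apply: is_derive_eq h _.
rewrite /= /GRing.scale/= mulr1 factS natrM; field.
by rewrite addrC natr1 !pnatr_eq0 -lt0n fact_gt0.
Qed.

Lemma is_derive_sin_taylor (k : nat) (x : R) :
  is_derive x (1 : R) (sin_taylor k) (cos_taylor k x).
Proof.
have -> : sin_taylor k = \sum_(i < k) (fun y : R => (-1) ^+ i * y ^+ i.*2.+1 / (i.*2.+1)`!%:R).
  by apply/funext => y; rewrite fct_sumE.
by apply: is_derive_sum => i; exact: is_derive_pow_fact.
Qed.

Lemma is_derive_cos_taylor (k : nat) (x : R) :
  is_derive x (1 : R) (cos_taylor k.+1) (- sin_taylor k x).
Proof.
have -> : cos_taylor k.+1 = cst 1 + \sum_(i < k) (fun y : R => (-1) ^+ i.+1 * y ^+ i.*2.+2 / (i.*2.+2)`!%:R).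
  apply/funext => y; rewrite /cos_taylor big_ord_recl/= !fctE fct_sumE.
  by congr (_ + _); rewrite ?expr0 ?fact0 ?divr1 ?mulr1.
have -> : - sin_taylor k x = 0 + \sum_(i < k) ((-1) ^+ i.+1 * x ^+ i.*2.+1 / (i.*2.+1)`!%:R).
  by rewrite add0r /sin_taylor -sumrN; apply: eq_bigr => i _; rewrite [in RHS](exprS (-1)) mulN1r !mulNr.
apply: is_deriveD; apply: is_derive_sum => i; exact: is_derive_pow_fact.
Qed.

Lemma norm_le_of_derive_le (f g df dg : R -> R) (y : R) : 0 <= y ->
  (forall x, is_derive x (1 : R) f (df x)) ->
  (forall x, is_derive x (1 : R) g (dg x)) ->
  f 0 = 0 -> g 0 = 0 -> (forall x, 0 <= x -> `|df x| <= dg x) -> `|f y| <= g y.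
Proof.
move=> y0 f' g' f0 g0 dfg; rewrite ler_norml; apply/andP; split.
  rewrite lerNl; apply: (@le_of_derive_le (- f) g (fun x => - df x) dg) => //.
  - by rewrite fctE f0 g0 oppr0.
  - by move=> x /dfg; rewrite ler_norml => /andP[+ _]; rewrite lerNl.
apply: (@le_of_derive_le f g df dg) => //; first by rewrite f0.
by move=> x /dfg; rewrite ler_norml => /andP[].
Qed.

(** The sine remainder vanishes at 0 and its derivative is the cosine remainder, so the bound
    integrates. [cos_taylor_step] is the other half of the alternation, which starts from the empty
    sum and the bound 1 on the cosine. *)
Lemma sin_taylor_step (k : nat) :
  (forall y : R, 0 <= y -> `|cos y - cos_taylor k y| <= y ^+ k.*2 / (k.*2)`!%:R) ->
  forall y : R, 0 <= y -> `|sin y - sin_taylor k y| <= y ^+ k.*2.+1 / (k.*2.+1)`!%:R.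
Proof.
move=> H y y0; rewrite -[y ^+ _]mul1r.
apply: (@norm_le_of_derive_le (sin - sin_taylor k) _ (fun x => cos x - cos_taylor k x) _ _ y0 _
  (fun x => is_derive_pow_fact k.*2 x 1)).
- by move=> x; apply: is_deriveB; exact: is_derive_sin_taylor.
- rewrite !fctE sin0 sub0r /sin_taylor big1 ?oppr0// => i _.
  by rewrite expr0n mulr0 mul0r.
- by rewrite expr0n mulr0 mul0r.
- by move=> x /H; rewrite mul1r.
Qed.

Lemma cos_taylor_step (k : nat) :
  (forall y : R, 0 <= y -> `|sin y - sin_taylor k y| <= y ^+ k.*2.+1 / (k.*2.+1)`!%:R) ->
  forall y : R, 0 <= y -> `|cos y - cos_taylor k.+1 y| <= y ^+ k.+1.*2 / (k.+1.*2)`!%:R.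
Proof.
move=> H y y0; rewrite -[y ^+ _]mul1r.
apply: (@norm_le_of_derive_le (cos - cos_taylor k.+1) _ (fun x => - sin x - - sin_taylor k x) _ _ y0 _
  (fun x => is_derive_pow_fact k.*2.+1 x 1)).
- by move=> x; apply: is_deriveB; exact: is_derive_cos_taylor.
- rewrite !fctE cos0 /cos_taylor big_ord_recl big1 => [|i _].
    by rewrite !expr0 fact0 divr1 mulr1 addr0 subrr.
  by rewrite expr0n mulr0 mul0r.
- by rewrite expr0n mulr0 mul0r.
- by move=> x /H; rewrite mul1r -opprD normrN.
Qed.

Lemma cos_taylor_ge0 (k : nat) (y : R) : 0 <= y ->
  `|cos y - cos_taylor k y| <= y ^+ k.*2 / (k.*2)`!%:R.
Proof.
elim: k y => [|k IH] y y0; last exact/cos_taylor_step/y0/sin_taylor_step.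
by rewrite /cos_taylor big_ord0 subr0 expr0 fact0 divr1 cos_max.
Qed.

Lemma cos_taylor_le (k : nat) (y : R) :
  `|cos y - cos_taylor k y| <= y ^+ k.*2 / (k.*2)`!%:R.
Proof.
have ev j : y ^+ j.*2 = `|y| ^+ j.*2 by rewrite -!muln2 mulnC !exprM real_normK ?num_real.
have -> : cos_taylor k y = cos_taylor k `|y| by apply: eq_bigr => i _; rewrite ev.
by rewrite -cos_norm ev cos_taylor_ge0.
Qed.

Lemma sin_taylor_le (k : nat) (y : R) :
  `|sin y - sin_taylor k y| <= `|y| ^+ k.*2.+1 / (k.*2.+1)`!%:R.
Proof.
have h := fun k => sin_taylor_step (@cos_taylor_ge0 k).
have [y0|y0] := leP 0 y; first by rewrite (ger0_norm y0) h.
have yE : y = - `|y| by rewrite ltr0_norm ?opprK.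
have -> : sin_taylor k y = - sin_taylor k `|y|.
  rewrite /sin_taylor -sumrN; apply: eq_bigr => i _.
  have e : (-1) ^+ i.*2.+1 = -1 :> R by rewrite -signr_odd/= odd_double expr1.
  by rewrite {1}yE (exprNn `|y|) e mulN1r mulrN mulNr.
by rewrite {1}yE sinN -opprD normrN h.
Qed.
End TrigTaylor.

(** * Steps as polynomials in a sine *)

Section StepPolynomial.
Variable R : realType.

Lemma bernoulli_ineq (x : R) (n : nat) : -1 <= x -> 1 + n%:R * x <= (1 + x) ^+ n.
Proof.
move=> x1; elim: n => [|n IH]; first by rewrite mul0r addr0 expr0.
rewrite exprS; apply: le_trans (ler_wpM2l _ IH); last by lra.
rewrite -natr1; have : 0 <= n%:R * x ^+ 2 by rewrite mulr_ge0 ?sqr_ge0.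
rewrite expr2; move: (n%:R : R) => k; nra.
Qed.

(* Since [2 ^ n * u ^ n = (2 u) ^ n], this tends to 1 for [u < 1/2] and to 0 for [u > 1/2]. *)
Definition step_val (n : nat) (u : R) : R := (1 - u ^+ n) ^+ (2 ^ n).

Lemma step_val_itv (n : nat) (u : R) : 0 <= u <= 1 -> 0 <= step_val n u <= 1.
Proof.
move=> /andP[u0 u1]; have un0 : 0 <= u ^+ n by rewrite exprn_ge0.
have un1 : u ^+ n <= 1 by rewrite exprn_ile1.
by rewrite exprn_ge0/= ?exprn_ile1//; lra.
Qed.

Lemma step_val_ge (n : nat) (u k : R) : 0 <= u <= 1 -> u <= 1 / 2 - k ->
  1 - (1 - 2 * k) ^+ n <= step_val n u.
Proof.
move=> /andP[u0 u1] uk.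
have un1 : u ^+ n <= 1 by rewrite exprn_ile1.
apply: le_trans (bernoulli_ineq _ _); last by lra.
rewrite lerD2l mulrN lerN2 natrX -exprMn lerXn2r ?nnegrE//; lra.
Qed.

(** Multiplying [(1 - u ^+ n) ^+ (2 ^ n)] by [(1 + u ^+ n) ^+ (2 ^ n)] gives at most 1, and by
    Bernoulli the second factor is at least [(2 u) ^+ n]. *)
Lemma step_val_le (n : nat) (u k : R) : 0 <= k -> 0 <= u <= 1 -> 1 / 2 + k <= u ->
  step_val n u <= ((1 + 2 * k)^-1) ^+ n.
Proof.
move=> k0 /andP[u0 u1] uk.
have un0 : 0 <= u ^+ n by rewrite exprn_ge0.
have un1 : u ^+ n <= 1 by rewrite exprn_ile1.
have k1 : 0 < (1 + 2 * k) ^+ n by rewrite exprn_gt0//; lra.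
rewrite exprVn -[leRHS]mul1r ler_pdivlMr//.
have h : (1 + 2 * k) ^+ n <= (1 + u ^+ n) ^+ (2 ^ n).
  apply: le_trans (bernoulli_ineq _ _); last by lra.
  rewrite natrX -exprMn -[leLHS]add0r lerD// lerXn2r ?nnegrE//; lra.
have q0 : 0 <= step_val n u by have /andP[] := step_val_itv n (introT andP (conj u0 u1)).
apply: (le_trans (ler_wpM2l q0 h)); rewrite -exprMn exprn_ile1//.
  by rewrite mulr_ge0; lra.
by nra.
Qed.

Lemma expr_small (z e : R) : 0 <= z < 1 -> 0 < e -> exists n0 : nat, forall n, (n0 <= n)%N -> z ^+ n <= e.
Proof.
move=> /andP[z0 z1] e0.
have : (fun n => z ^+ n) @ \oo --> (0 : R).
  by apply: cvg_expr; rewrite ger0_norm.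
move=> /cvgrPdist_le /(_ e e0) [n0 _ h]; exists n0 => n /h /=.
by rewrite sub0r normrN ger0_norm// exprn_ge0.
Qed.

(** The frequency [b] makes [sin (b * x)] increasing on [[-A, A]], where a polynomial step in the
    sine with threshold at [z], the midpoint of [y] and [y + d], is a step in [x]. Beyond [A]
    periodicity spoils the shape, but the values stay in [[0, 1]] and [e * x ^+ 2] exceeds 1. *)
Lemma trig_step_approx (y d e : R) : 0 < d -> 0 < e ->
  exists (b : R) (q : {poly R}), forall x,
    (x <= y)%R%:R - e - e * x ^+ 2 <= q.[sin (b * x)] <= (x <= y + d)%R%:R + e + e * x ^+ 2.
Proof.
move=> d0 e0.
(* Large enough for [[-A, A]] to contain [y] and [y + d]; the summand [e^-1] yields
   [1 <= e * A <= e * A ^+ 2]. *)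
pose A : R := `|y| + d + e^-1 + 1.
have einv : 0 < e^-1 by rewrite invr_gt0.
have A1 : 1 <= A by rewrite /A; have := normr_ge0 y; lra.
have Ae : 1 <= e * A ^+ 2.
  have : 1 <= e * A.
    have -> : 1 = e * e^-1 by rewrite mulfV ?gt_eqF.
    by rewrite ler_pM2l// /A; have := normr_ge0 y; lra.
  by rewrite expr2; nra.
pose b := pi / 2 / A.
have pi0 := pi_gt0 R.
have b0 : 0 < b by rewrite !divr_gt0//; lra.
have bA : b * A = pi / 2 by rewrite /b divfK// gt_eqF//; lra.
have bin x : `|x| <= A -> b * x \in `[- (pi / 2), pi / 2].
  rewrite in_itv/= -bA -mulrN !(ler_pM2l b0) => /[!ler_norml] /andP[h1 h2].
  by rewrite h1.
pose z := y + d / 2.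
have zA : `|z| <= A.
  apply: (le_trans (ler_normD _ _)); rewrite (gtr0_norm (_ : 0 < d / 2)) ?divr_gt0//.
  by rewrite /A; lra.
have yA : `|y| <= A by rewrite /A; lra.
have ydA : `|y + d| <= A.
  by apply: (le_trans (ler_normD _ _)); rewrite (gtr0_norm d0) /A; lra.
have s1 : sin (b * y) < sin (b * z) by rewrite ltr_sin ?bin// ltr_pM2l// /z; lra.
have s2 : sin (b * z) < sin (b * (y + d)) by rewrite ltr_sin ?bin// ltr_pM2l// /z; lra.
(* The margin left around 1/2: the smaller gap between the sines, divided by 4 because [u] below
   rescales a difference of sines by 1/4, so as to land in [[0, 1]]. *)
pose k : R := Num.min (sin (b * z) - sin (b * y)) (sin (b * (y + d)) - sin (b * z)) / 4.
have k0 : 0 < k by rewrite divr_gt0// lt_min !subr_gt0 s1 s2.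
have k1 : k <= (sin (b * z) - sin (b * y)) / 4 by rewrite ler_pM2r ?invr_gt0// ge_min lexx.
have k2 : k <= (sin (b * (y + d)) - sin (b * z)) / 4 by rewrite ler_pM2r ?invr_gt0// ge_min lexx orbT.
have kle : k <= 1 / 2 by have := sin_le1 (b * z); have := sin_geN1 (b * y); lra.
have [|n1 hn1] := @expr_small (1 - 2 * k) e _ e0; first by apply/andP; split; lra.
have [|n2 hn2] := @expr_small ((1 + 2 * k)^-1) e _ e0.
  by apply/andP; split; rewrite ?invr_ge0 ?invf_lt1; lra.
pose n := maxn n1 n2.
exists b, ((1 - (2^-1%:P + 4^-1%:P * ('X - (sin (b * z))%:P)) ^+ n) ^+ (2 ^ n)) => x.
set u := 2^-1 + 4^-1 * (sin (b * x) - sin (b * z)).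
have -> : ((1 - (2^-1%:P + 4^-1%:P * ('X - (sin (b * z))%:P)) ^+ n) ^+ (2 ^ n)).[sin (b * x)]
   = step_val n u by rewrite /step_val /u !(hornerE, horner_exp).
have u01 : 0 <= u <= 1.
  have := sin_le1 (b * z); have := sin_geN1 (b * z).
  have := sin_le1 (b * x); have := sin_geN1 (b * x).
  by rewrite /u => *; apply/andP; split; lra.
have /andP[q0 q1] := step_val_itv n u01.
have [xA|Ax] := leP `|x| A; last first.
  have h : 1 <= e * x ^+ 2.
    apply: (le_trans Ae); rewrite ler_pM2l// -(real_normK (num_real x)).
    by rewrite lerXn2r ?nnegrE// ?ltW//; lra.
  by case: (x <= y); case: (x <= y + d) => /=; apply/andP; split; lra.
have ex0 : 0 <= e * x ^+ 2 by rewrite mulr_ge0 ?sqr_ge0// ltW.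
have mono v : `|v| <= A -> v <= x -> sin (b * v) <= sin (b * x).
  move=> vA; rewrite le_eqVlt => /orP[/eqP ->//|vx].
  by rewrite ltW// ltr_sin ?bin// ltr_pM2l.
have mono' v : `|v| <= A -> x <= v -> sin (b * x) <= sin (b * v).
  move=> vA; rewrite le_eqVlt => /orP[/eqP ->//|vx].
  by rewrite ltW// ltr_sin ?bin// ltr_pM2l.
apply/andP; split.
  have [xy|yx] /= := leP x y; last by lra.
  have uk : u <= 1 / 2 - k by rewrite /u; have := mono' _ yA xy; lra.
  have := step_val_ge n u01 uk; have := hn1 n (leq_maxl _ _).
  by move: (_ ^+ n) (step_val _ _) => ? ?; lra.
have [xy|yx] /= := leP x (y + d); first by lra.
have uk : 1 / 2 + k <= u by rewrite /u; have := mono _ ydA (ltW yx); lra.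
have := step_val_le n (ltW k0) u01 uk; have := hn2 n (leq_maxr _ _).
by move: (_ ^+ n) (step_val _ _) => ? ?; lra.
Qed.
End StepPolynomial.

(** * Test functions whose means are determined by gaussian moments *)

Section Means.
Variable R : realType.

Fixpoint gauss_moment (r : nat) : R :=
  match r with
  | 0 => 1
  | 1 => 0
  | r'.+2 => r'.+1%:R * gauss_moment r'
  end.

(* Outside [D] the values of [F] are junk (the integral of a non-integrable function). *)
Record is_mean (D : (R -> R) -> Prop) (F : (R -> R) -> R) : Prop := IsMean {
  mean_cont : forall f : R -> R, continuous f -> D f;
  mean_step : forall y, D (fun x => (x <= y)%R%:R);
  mean_comb : forall a f g, D f -> D g -> D (fun x => a * f x + g x);
  mean_lin : forall a f g, D f -> D g -> F (fun x => a * f x + g x) = a * F f + F g;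
  mean_le : forall f g, D f -> D g -> (forall x, f x <= g x) -> F f <= F g }.

Definition gaussian_means (D : nat -> (R -> R) -> Prop) (F : nat -> (R -> R) -> R) :=
  (forall n, is_mean (D n) (F n)) /\
  forall r, (fun n => F n (fun x => x ^+ r)) @ \oo --> gauss_moment r.

(* Comparing two sequences with gaussian moments avoids identifying the common limit. *)
Definition determined (f : R -> R) := continuous f /\
  forall D F D' G, gaussian_means D F -> gaussian_means D' G ->
    (fun n => F n f - G n f) @ \oo --> (0 : R).

Lemma continuous_comb (a : R) (f g : R -> R) :
  continuous f -> continuous g -> continuous (fun x => a * f x + g x).
Proof.
move=> cf cg x; apply: (@cvgD _ R^o); last exact: cg.
by apply: (@cvgM R); [exact: cvg_cst|exact: cf].
Qed.

Lemma determined_comb (a : R) (f g : R -> R) :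
  determined f -> determined g -> determined (fun x => a * f x + g x).
Proof.
move=> [cf df] [cg dg]; split; first exact: continuous_comb.
move=> D F D' G [mF hF] [mG hG].
have -> : (fun n => F n (fun x => a * f x + g x) - G n (fun x => a * f x + g x)) =
    (fun n => a * (F n f - G n f) + (F n g - G n g)).
  apply/funext => n; rewrite (mean_lin (mF n)) ?(mean_lin (mG n)).
  + by ring.
  + exact: mean_cont (mG n) _ cf.
  + exact: mean_cont (mG n) _ cg.
  + exact: mean_cont (mF n) _ cf.
  + exact: mean_cont (mF n) _ cg.
rewrite -[0 in X in _ --> X](addr0 (0 : R)) -[X in _ --> X + _](mulr0 a).
apply: (@cvgD _ R^o); last exact: (dg D F D' G).
by apply: (@cvgM R); [exact: cvg_cst|exact: (df D F D' G)].
Qed.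

Lemma determined_pow (r : nat) : determined (fun x => x ^+ r).
Proof.
split; first exact: exprn_continuous.
move=> D F D' G [mF hF] [mG hG].
by rewrite -(subrr (gauss_moment r)); apply: (@cvgB _ R^o); [exact: hF|exact: hG].
Qed.

Lemma determined_cst (a : R) : determined (fun=> a).
Proof.
have -> : (fun=> a) = (fun x : R => (a - 1) * x ^+ 0 + x ^+ 0).
  by apply/funext => x; rewrite !expr0; ring.
by apply: determined_comb; exact: determined_pow.
Qed.

Lemma determined_scale (a : R) (f : R -> R) : determined f -> determined (fun x => a * f x).
Proof.
move=> df; have -> : (fun x => a * f x) = (fun x => a * f x + 0).
  by apply/funext => x; rewrite addr0.
by apply: determined_comb => //; exact: determined_cst.
Qed.

Lemma determined_sum (n : nat) (f : nat -> R -> R) :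
  (forall i, (i < n)%N -> determined (f i)) -> determined (fun x => \sum_(i < n) f i x).
Proof.
elim: n => [|n IH] df.
  have -> : (fun x => \sum_(i < 0) f i x) = (fun=> 0) by apply/funext => x; rewrite big_ord0.
  exact: determined_cst.
have -> : (fun x => \sum_(i < n.+1) f i x) = (fun x => 1 * (\sum_(i < n) f i x) + f n x).
  by apply/funext => x; rewrite big_ord_recr/= mul1r.
by apply: determined_comb; [apply: IH => i ilt; apply: df; rewrite ltnW|exact: df].
Qed.

Lemma mean_scale D F (a : R) (f : R -> R) : is_mean D F -> D f -> F (fun x => a * f x) = a * F f.
Proof.
move=> mF Df.
have D0 : D (fun=> 0) by apply: (mean_cont mF) => x; exact: cvg_cst.
have F0 : F (fun=> 0) = 0.
  have := mean_lin mF (-1) D0 D0.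
  have -> : (fun _ : R => -1 * 0 + 0) = (fun=> 0 : R) by apply/funext => x; rewrite mulr0 addr0.
  by rewrite mulN1r addNr.
have -> : (fun x => a * f x) = (fun x => a * f x + 0) by apply/funext => x; rewrite addr0.
by rewrite (mean_lin mF)// F0 addr0.
Qed.

Definition gauss_limit (h : R -> R) (l : R) := continuous h /\
  forall D F, gaussian_means D F -> (fun n => F n h) @ \oo --> l.

(** The approximation needs to be good only in mean: the majorant [h] may be unbounded, provided
    that its own means have a small limit. *)
Lemma determined_approx (f : R -> R) : continuous f ->
  (forall e : R, 0 < e -> exists T h l,
     [/\ determined T, gauss_limit h l, l <= e & forall x, `|f x - T x| <= h x]) ->
  determined f.
Proof.
move=> cf ap; split=> // D F D' G gF gG.
apply/cvgrPdist_le => e e0.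
(* One fifth for the difference of the means of [T], and two fifths for each mean of [h]: its limit
   and its distance to it. *)
have [|T [h [l [[cT dT] [ch hl] le fT]]]] := ap (e / 5); first by rewrite divr_gt0.
have e5 : 0 < e / 5 by rewrite divr_gt0.
have := dT D F D' G gF gG => /cvgrPdist_le /(_ _ e5) dT'.
have := hl D F gF => /cvgrPdist_le /(_ _ e5) hF.
have := hl D' G gG => /cvgrPdist_le /(_ _ e5) hG.
have bd DD FF : is_mean DD FF -> `|FF f - FF T| <= FF h.
  move=> m; have Df := mean_cont m cf; have DT := mean_cont m cT; have Dh := mean_cont m ch.
  have up : FF f <= FF h + FF T.
    rewrite -[FF h]mul1r -(mean_lin m)//; apply: (mean_le m) => //; first exact: (mean_comb m).
    by move=> x; have := fT x; rewrite ler_norml mul1r => /andP[_ ?]; lra.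
  have lo : FF T <= FF h + FF f.
    rewrite -[FF h]mul1r -(mean_lin m)//; apply: (mean_le m) => //; first exact: (mean_comb m).
    by move=> x; have := fT x; rewrite ler_norml mul1r => /andP[? _]; lra.
  by rewrite ler_norml; apply/andP; split; lra.
near=> n.
have : `|0 - (F n T - G n T)| <= e / 5 by near: n.
have : `|l - F n h| <= e / 5 by near: n.
have : `|l - G n h| <= e / 5 by near: n.
have := bd _ _ (gF.1 n); have := bd _ _ (gG.1 n).
rewrite !ler_norml => /andP[? ?] /andP[? ?] /andP[? ?] /andP[? ?] /andP[? ?].
by apply/andP; split; lra.
Unshelve. all: by end_near. Qed.

(** The even moments are the double factorials [(2 k - 1)!!]. Divided by [(2 k)!] they turn the mean
    of a Taylor remainder of [cos (t * x)] into a term of the series of [exp (t ^ 2 / 2)], hence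
    small for large [k]. *)
Lemma gauss_moment_even (k : nat) : gauss_moment k.*2 / (k.*2)`!%:R = (2^-1) ^+ k / k`!%:R.
Proof.
elim: k => [|k IH]; first by rewrite /= !fact0 expr0.
rewrite doubleS [gauss_moment _]/= factS natrM.
rewrite [in X in _ / (_ * X)]factS natrM.
have gen (a b f g : R) : a != 0 -> b != 0 -> f != 0 ->
    a * g / (b * (a * f)) = g / f / b.
  by move=> a0 b0 f0; field; rewrite a0 b0 f0.
have nz m : m.+1%:R != 0 :> R by rewrite pnatr_eq0.
have fz m : m`!%:R != 0 :> R by rewrite pnatr_eq0 -lt0n fact_gt0.
rewrite gen// IH exprS factS natrM -doubleS -mul2n natrM.
have gen2 (a f g : R) : a != 0 -> f != 0 -> g / f / (2 * a) = 2^-1 * g / (a * f).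
  by move=> a0 f0; field; rewrite a0 f0.
exact: gen2.
Qed.

Definition pow_term (t : R) (k : nat) (x : R) : R := (t * x) ^+ k.*2 / (k.*2)`!%:R.

Lemma pow_term_limit (t : R) (k : nat) :
  gauss_limit (pow_term t k) ((t ^+ 2 / 2) ^+ k / k`!%:R).
Proof.
have pE : pow_term t k = (fun x => t ^+ k.*2 / (k.*2)`!%:R * x ^+ k.*2).
  by apply/funext => x; rewrite /pow_term exprMn mulrAC.
rewrite pE; split.
  by move=> x; apply: (@cvgM R); [exact: cvg_cst|exact: exprn_continuous].
move=> D F [mF hF].
have -> : (t ^+ 2 / 2) ^+ k / k`!%:R = t ^+ k.*2 / (k.*2)`!%:R * gauss_moment k.*2.
  transitivity (t ^+ k.*2 * (2^-1 ^+ k / k`!%:R)).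
    by rewrite exprMn -exprM mul2n mulrA.
  by rewrite -gauss_moment_even mulrCA mulrC.
under eq_fun => n do rewrite (mean_scale _ (mF n) (mean_cont (mF n) (@exprn_continuous R _))).
by apply: (@cvgM R); [exact: cvg_cst|exact: hF].
Qed.

Lemma exp_term_small (s e : R) : 0 < e ->
  exists k0 : nat, forall k, (k0 <= k)%N -> s ^+ k / k`!%:R <= e.
Proof.
move=> e0.
have : (exp_coeff s) @ \oo --> (0 : R) by apply: cvg_series_cvg_0; exact: is_cvg_series_exp_coeff.
move=> /cvgrPdist_le /(_ e e0) [k0 _ h]; exists k0 => k /h /=.
by rewrite sub0r normrN; apply: le_trans; exact: ler_norm.
Qed.

Lemma determined_cos (t : R) : determined (fun x => cos (t * x)).
Proof.
apply: determined_approx.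
  move=> x; apply: continuous_comp; last exact: continuous_cos.
  by apply: (@cvgM R); [exact: cvg_cst|exact: cvg_id].
move=> e e0; have [k hk] := @exp_term_small (t ^+ 2 / 2) e e0.
exists (fun x => cos_taylor k (t * x)), (pow_term t k), ((t ^+ 2 / 2) ^+ k / k`!%:R); split.
- rewrite /cos_taylor; apply: (@determined_sum k (fun i x => (-1) ^+ i * (t * x) ^+ i.*2 / (i.*2)`!%:R)) => i _.
  have -> : (fun x => (-1) ^+ i * (t * x) ^+ i.*2 / (i.*2)`!%:R) =
      (fun x => ((-1) ^+ i * t ^+ i.*2 / (i.*2)`!%:R) * x ^+ i.*2).
    by apply/funext => x; rewrite exprMn; ring.
  exact/determined_scale/determined_pow.
- exact: pow_term_limit.
- exact: hk.
- by move=> x; exact: cos_taylor_le.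
Qed.

(** The sine remainder is an odd power of [|y|], whose mean is not among the moments; completing a
    square bounds it by the two neighbouring even powers. *)
Lemma odd_pow_fact_le (y : R) (k : nat) :
  `|y| ^+ k.*2.+1 / (k.*2.+1)`!%:R <= y ^+ k.*2 / (k.*2)`!%:R + y ^+ k.+1.*2 / (k.+1.*2)`!%:R.
Proof.
have ev j : y ^+ j.*2 = `|y| ^+ j.*2 by rewrite -!muln2 mulnC !exprM real_normK ?num_real.
rewrite !ev doubleS !factS !natrM !exprS; move: (normr_ge0 y); move: (`|y|) => z z0.
have f0 : 0 < (k.*2)`!%:R :> R by rewrite ltr0n fact_gt0.
rewrite -(natr1 k.*2.+1); set a : R := k.*2.+1%:R.
have a1 : 1 <= a by rewrite ler1n.
have zk : 0 <= z ^+ k.*2 / (k.*2)`!%:R by rewrite divr_ge0 ?exprn_ge0// ltW.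
have -> : z * z ^+ k.*2 / (a * (k.*2)`!%:R) = z / a * (z ^+ k.*2 / (k.*2)`!%:R).
  by field; apply/andP; split; rewrite gt_eqF//; lra.
have -> : z ^+ k.*2 / (k.*2)`!%:R + z * (z * z ^+ k.*2) / ((a + 1) * (a * (k.*2)`!%:R)) =
   (1 + z * z / ((a + 1) * a)) * (z ^+ k.*2 / (k.*2)`!%:R).
  by field; rewrite !gt_eqF//; lra.
rewrite ler_wpM2r//.
have -> : 1 + z * z / ((a + 1) * a) = ((a + 1) * a + z * z) / (a + 1) / a.
  by field; apply/andP; split; rewrite gt_eqF//; lra.
rewrite ler_pM2r ?invr_gt0; last by lra.
rewrite ler_pdivlMr; last by lra.
have := sqr_ge0 (z - (a + 1) / 2); rewrite expr2; nra.
Qed.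

Lemma determined_sin (t : R) : determined (fun x => sin (t * x)).
Proof.
apply: determined_approx.
  move=> x; apply: continuous_comp; last exact: continuous_sin.
  by apply: (@cvgM R); [exact: cvg_cst|exact: cvg_id].
move=> e e0; have [|k hk] := @exp_term_small (t ^+ 2 / 2) (e / 2) _; first by rewrite divr_gt0.
have [c1 h1] := pow_term_limit t k; have [c2 h2] := pow_term_limit t k.+1.
exists (fun x => sin_taylor k (t * x)), (fun x => pow_term t k x + pow_term t k.+1 x),
  ((t ^+ 2 / 2) ^+ k / k`!%:R + (t ^+ 2 / 2) ^+ k.+1 / k.+1`!%:R); split.
- rewrite /sin_taylor; apply: (@determined_sum k (fun i x => (-1) ^+ i * (t * x) ^+ i.*2.+1 / (i.*2.+1)`!%:R)) => i _.
  have -> : (fun x => (-1) ^+ i * (t * x) ^+ i.*2.+1 / (i.*2.+1)`!%:R) =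
      (fun x => ((-1) ^+ i * t ^+ i.*2.+1 / (i.*2.+1)`!%:R) * x ^+ i.*2.+1).
    by apply/funext => x; rewrite exprMn; ring.
  exact/determined_scale/determined_pow.
- have -> : (fun x => pow_term t k x + pow_term t k.+1 x) =
     (fun x => 1 * pow_term t k x + pow_term t k.+1 x) by apply/funext => x; rewrite mul1r.
  split; first exact: continuous_comb.
  move=> D F gF; have [mF hF] := gF.
  under eq_fun => n do rewrite (mean_lin (mF n) _ (mean_cont (mF n) c1) (mean_cont (mF n) c2)) mul1r.
  by apply: (@cvgD _ R^o); [exact: (h1 D F gF)|exact: (h2 D F gF)].
- have := hk k (leqnn k); have := hk k.+1 (leqnSn k); lra.
- by move=> x; apply: (le_trans (sin_taylor_le _ _)); exact: odd_pow_fact_le.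
Qed.

(** The product formulas trade a factor [sin (b * x)] for a shift of [a] by [b] or [- b] and
    exchange sine with cosine; therefore [a] is arbitrary and both families go through the induction
    together. *)
Lemma determined_trig (b : R) (n : nat) : forall a : R,
  determined (fun x => cos (a * x) * sin (b * x) ^+ n) /\
  determined (fun x => sin (a * x) * sin (b * x) ^+ n).
Proof.
elim: n => [|n IH] a.
  split.
    under eq_fun do rewrite expr0 mulr1; exact: determined_cos.
  under eq_fun do rewrite expr0 mulr1; exact: determined_sin.
have [c1 s1] := IH (a + b); have [c2 s2] := IH (a - b); split.
  have -> : (fun x => cos (a * x) * sin (b * x) ^+ n.+1) =
     (fun x => (- 2^-1) * (sin ((a - b) * x) * sin (b * x) ^+ n) +
         (2^-1 * (sin ((a + b) * x) * sin (b * x) ^+ n))).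
    by apply/funext => x; rewrite exprS [(a + b) * x]mulrDl [(a - b) * x]mulrBl sinB sinD; field.
  by apply: determined_comb => //; exact: determined_scale.
have -> : (fun x => sin (a * x) * sin (b * x) ^+ n.+1) =
   (fun x => (- 2^-1) * (cos ((a + b) * x) * sin (b * x) ^+ n) +
       (2^-1 * (cos ((a - b) * x) * sin (b * x) ^+ n))).
  by apply/funext => x; rewrite exprS [(a + b) * x]mulrDl [(a - b) * x]mulrBl cosB cosD; field.
by apply: determined_comb => //; exact: determined_scale.
Qed.

Lemma determined_poly_sin (q : {poly R}) (b : R) : determined (fun x => q.[sin (b * x)]).
Proof.
have -> : (fun x => q.[sin (b * x)]) = (fun x => \sum_(i < size q) q`_i * sin (b * x) ^+ i).
  by apply/funext => x; rewrite horner_coef.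
apply: (@determined_sum _ (fun i x => q`_i * sin (b * x) ^+ i)) => i _.
apply: determined_scale.
have [+ _] := determined_trig b i 0.
by under eq_fun do rewrite mul0r cos0 mul1r.
Qed.

(** A polynomial in a sine is inserted between the two steps, and its means under both sequences
    agree in the limit. The shift [d] leaves room for the transition; being one-sided, the lemma
    serves for both directions by exchanging the sequences. *)
Lemma gaussian_means_step_le D F D' G (y d e : R) : gaussian_means D F -> gaussian_means D' G ->
  0 < d -> 0 < e ->
  \forall n \near \oo, F n (fun x => (x <= y)%R%:R) <= G n (fun x => (x <= y + d)%R%:R) + e.
Proof.
move=> gF gG d0 e0; have [mF hF] := gF; have [mG hG] := gG.
(* Eventually the means of [1] and [x ^+ 2] under [F] and [G] are at most 2, which costs [8 * c];
   the comparison of the polynomial costs one more [c]. *)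
pose c := e / 9; have c0 : 0 < c by rewrite divr_gt0.
have [b [q qb]] := trig_step_approx y d0 c0.
have [cq dq] := determined_poly_sin q b.
have := dq D F D' G gF gG => /cvgrPdist_le /(_ _ c0) dq'.
have := hF 0 => /cvgrPdist_le /(_ _ ltr01) F0.
have := hF 2 => /cvgrPdist_le /(_ _ ltr01) F2.
have := hG 0 => /cvgrPdist_le /(_ _ ltr01) G0.
have := hG 2 => /cvgrPdist_le /(_ _ ltr01) G2.
near=> n.
have : `|0 - (F n (fun x => q.[sin (b * x)]) - G n (fun x => q.[sin (b * x)]))| <= c by near: n.
have : `|gauss_moment 0 - F n (fun x => x ^+ 0)| <= 1 by near: n.
have : `|gauss_moment 2 - F n (fun x => x ^+ 2)| <= 1 by near: n.
have : `|gauss_moment 0 - G n (fun x => x ^+ 0)| <= 1 by near: n.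
have : `|gauss_moment 2 - G n (fun x => x ^+ 2)| <= 1 by near: n.
rewrite !ler_norml /= mulr1 => /andP[g2 _] /andP[g0 _] /andP[f2 _] /andP[f0 _] /andP[h0 _].
have fle : F n (fun x => (x <= y)%R%:R) <=
    c * F n (fun x => x ^+ 0) + (c * F n (fun x => x ^+ 2) + F n (fun x => q.[sin (b * x)])).
  have D0 := mean_cont (mF n) (@exprn_continuous R 0).
  have D2 := mean_cont (mF n) (@exprn_continuous R 2).
  have Dq := mean_cont (mF n) cq.
  rewrite -(mean_lin (mF n))// -(mean_lin (mF n))//; last exact: (mean_comb (mF n)).
  apply: (mean_le (mF n)); [exact: (mean_step (mF n))| |].
    by do !apply: (mean_comb (mF n)) => //.
  by move=> x; have /andP[+ _] := qb x; rewrite expr0; lra.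
have gle : G n (fun x => q.[sin (b * x)]) <=
    c * G n (fun x => x ^+ 0) + (c * G n (fun x => x ^+ 2) + G n (fun x => (x <= y + d)%R%:R)).
  have D0 := mean_cont (mG n) (@exprn_continuous R 0).
  have D2 := mean_cont (mG n) (@exprn_continuous R 2).
  have Ds := mean_step (mG n) (y + d).
  rewrite -(mean_lin (mG n))// -(mean_lin (mG n))//; last exact: (mean_comb (mG n)).
  apply: (mean_le (mG n)); [exact: (mean_cont (mG n))| |].
    by do !apply: (mean_comb (mG n)) => //.
  by move=> x; have /andP[_ +] := qb x; rewrite expr0; lra.
have ec : e = 9 * c by rewrite /c mulrC divfK.
rewrite ec; nra.
Unshelve. all: by end_near. Qed.
End Means.

(** * The truncated normal law *)

Section Gauss.
Variable R : realType.
Local Notation mu := (@lebesgue_measure R).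
Local Notation phi := (normal_pdf (0 : R) 1).
Local Notation nu := (normal_prob (0 : R) 1).

Lemma phiE (x : R) : phi x = normal_peak 1 * expR (- (x ^+ 2) / 2).
Proof.
by rewrite normal_pdfE ?oner_neq0// /normal_fun subr0 expr1n.
Qed.

Lemma continuous_phi : continuous phi.
Proof. by apply: continuous_normal_pdf; rewrite oner_neq0. Qed.

Lemma is_derive_phi (x : R) : is_derive x (1 : R) phi (- (x * phi x)).
Proof.
have -> : phi = (fun x => normal_peak 1 * expR (- (x ^+ 2) / 2)).
  by apply/funext => y; exact: phiE.
have h1 : is_derive x (1 : R) (fun y : R => - (y ^+ 2) / 2) (- x).
  have := @is_deriveX _ _ (@id R) 2 x 1 1 (is_derive_id x 1).
  move=> /(@is_deriveZ _ _ _ _ (- 2^-1)).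
  have -> : (- 2^-1) \*: ((@id R) ^+ 2) = (fun y => - (y ^+ 2) / 2).
    by apply/funext => y; rewrite !fctE/=; change (- 2^-1 * y ^+ 2 = - y ^+ 2 / 2); ring.
  by move=> h; apply: is_derive_eq h _; rewrite /= /GRing.scale/= mulr1 expr1; field.
have h2 := @is_derive1_comp R (@expR R) (fun y => - (y ^+ 2) / 2) x _ _ (is_derive_expR _) h1.
have := is_deriveZ (normal_peak 1) h2.
move=> h; apply: is_derive_eq h _.
by rewrite /GRing.scale/=; ring.
Qed.

(** On a compact interval every continuous function is integrable against the density, as
    [mean_cont] demands. *)
Definition gauss_itv (n : nat) : set R := `[- n%:R, n%:R].

Definition gauss_dom (n : nat) (f : R -> R) : Prop :=
  mu.-integrable (gauss_itv n) (EFin \o (fun x => f x * phi x)).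

Definition gauss_int (n : nat) (f : R -> R) : R :=
  \int[mu]_(x in gauss_itv n) (f x * phi x).

Lemma measurable_gauss_itv n : measurable (gauss_itv n).
Proof. exact: measurable_itv. Qed.

Lemma gauss_is_mean (n : nat) : is_mean (gauss_dom n) (gauss_int n).
Proof.
have mI := measurable_gauss_itv n.
have cont (f : R -> R) : continuous f -> gauss_dom n f.
  move=> cf; apply: continuous_compact_integrable; first exact: segment_compact.
  apply: continuous_subspaceT => x.
  by apply: (@cvgM R); [exact: cf|exact: continuous_phi].
have comb a (f g : R -> R) : gauss_dom n f -> gauss_dom n g ->
    mu.-integrable (gauss_itv n) (EFin \o (fun x => a * (f x * phi x))).
  by move=> Df Dg; apply: (@integrableZl _ _ _ mu _ mI a _ Df).
have e (f g : R -> R) a : (fun x => (a * f x + g x) * phi x) =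
    (fun x => a * (f x * phi x) + g x * phi x).
  by apply/funext => x; ring.
split.
- exact: cont.
- move=> y; have c1 : continuous (fun _ : R => 1 : R) by exact: cst_continuous.
  have := cont _ c1.
  apply: le_integrable => //.
    apply/measurable_EFinP; apply: measurable_funM; last exact: measurable_funTS (measurable_normal_pdf 0 1).
    have -> : (fun x => (x <= y)%R%:R) = \1_(`]-oo, y]) :> (R -> R).
      by apply/funext => x; rewrite indicE mem_setE in_itv.
    exact: measurable_indic.
  move=> x _ /=; rewrite lee_fin !normrM ler_wpM2r//.
  by case: (x <= y); rewrite ?normr0 ?normr1.
- move=> a f g Df Dg; rewrite /gauss_dom e.
  exact: (@integrableD _ _ _ mu _ mI (EFin \o (fun x => a * (f x * phi x))) (EFin \o (fun x => g x * phi x)) (comb a f g Df Dg) Dg).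
- by move=> a f g Df Dg; rewrite /gauss_int e RintegralD ?RintegralZl//; exact: (comb a f g).
- move=> f g Df Dg fg; apply: le_Rintegral => // x _.
  by rewrite ler_wpM2r// normal_pdf_ge0.
Qed.

(** Since [x * phi x] is the derivative of [- phi], this is integration by parts. At [r = 0] the
    factor [r%:R] cancels the term with the default exponent [r.-1 = 0]. *)
Lemma gauss_int_parts (n r : nat) :
  gauss_int n.+1 (fun x => x ^+ r.+1) =
  r%:R * gauss_int n.+1 (fun x => x ^+ r.-1) -
  (n.+1%:R ^+ r * phi n.+1%:R - (- n.+1%:R) ^+ r * phi (- n.+1%:R)).
Proof.
have dX x : is_derive x (1 : R) (fun y : R => y ^+ r) (r%:R * x ^+ r.-1).
  have -> : (fun y : R => y ^+ r) = (@id R) ^+ r by apply/funext => y; rewrite fctE.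
  have := @is_deriveX _ _ (@id R) r x 1 1 (is_derive_id x 1).
  by move=> h; apply: is_derive_eq h _; rewrite /GRing.scale/= mulr1.
have dphi x : is_derive x (1 : R) (fun y : R => - phi y) (x * phi x).
  by have := is_deriveN (is_derive_phi x); rewrite opprK.
have cts (f g : R -> R) : (forall x, is_derive x (1 : R) f (g x)) -> continuous f.
  by move=> d x; apply: differentiable_continuous; apply/derivable1_diffP; have [] := d x.
have oo (f g : R -> R) : (forall x, is_derive x (1 : R) f (g x)) ->
    derivable_oo_LRcontinuous f (- n.+1%:R) n.+1%:R.
  move=> d; split.
  - by move=> x _; have [] := d x.
  - by apply: cvg_at_right_filter; exact: (cts _ _ d).
  - by apply: cvg_at_left_filter; exact: (cts _ _ d).
have lt : - n.+1%:R < n.+1%:R :> R by rewrite -subr_gt0 opprK -natrD ltr0n.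
have cid : continuous (fun x : R => r%:R * x ^+ r.-1).
  by move=> x; apply: (@cvgM R); [exact: cvg_cst|exact: exprn_continuous].
have cphi : continuous (fun x : R => x * phi x).
  by move=> x; apply: (@cvgM R); [exact: cvg_id|exact: continuous_phi].
have := @Rintegration_by_parts R (fun x => x ^+ r) (fun x => - phi x)
  (fun x => r%:R * x ^+ r.-1) (fun x => x * phi x) _ _ lt (continuous_subspaceT cid)
  (oo _ _ dX) _ (continuous_subspaceT cphi) (oo _ _ dphi) _.
move=> /(_ _ _)/wrap[] //.
- by move=> x _; rewrite derive1E; have [_ ->] := dX x.
- by move=> x _; rewrite derive1E; have [_ ->] := dphi x.
rewrite /gauss_int => E.
have -> : (fun x => x ^+ r.+1 * phi x) = (fun x => x ^+ r * (x * phi x)).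
  by apply/funext => x; rewrite exprSr mulrA.
rewrite E.
have -> : (fun x => r%:R * x ^+ r.-1 * - phi x) = (fun x => (- r%:R) * (x ^+ r.-1 * phi x)).
  by apply/funext => x; ring.
rewrite RintegralZl; first by ring.
- exact: measurable_gauss_itv.
- exact: (mean_cont (gauss_is_mean n.+1) (@exprn_continuous R _)).
Qed.

(** For [x >= 1] the density is at most its peak times [exp (- x / 2)], and the term of order
    [r + 1] of the series of [exp (x / 2)] beats [x ^+ r] with a factor [1 / x] to spare; this term
    is the origin of [c]. *)
Lemma gauss_boundary (r : nat) : (fun n => n.+1%:R ^+ r * phi n.+1%:R) @ \oo --> (0 : R).
Proof.
pose c : R := normal_peak 1 * (2 ^+ r.+1 * r.+1`!%:R).
have c0 : 0 <= c by rewrite mulr_ge0 ?normal_peak_ge0// mulr_ge0 ?exprn_ge0.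
apply: (@squeeze_cvgr _ \oo _ R (cst 0) (fun n => c * n.+1%:R^-1)).
- apply: nearW => n /=; rewrite mulr_ge0 ?exprn_ge0 ?normal_pdf_ge0//=.
  rewrite phiE /c; set x : R := n.+1%:R.
  have x1 : 1 <= x by rewrite ler1n.
  have x0 : 0 < x by lra.
  rewrite mulrCA -!mulrA ler_wpM2l ?normal_peak_ge0//.
  have h1 : expR (- x ^+ 2 / 2) <= (expR (x / 2))^-1.
    by rewrite -expRN ler_expR expr2; nra.
  apply: le_trans (ler_wpM2l (exprn_ge0 _ (ltW x0)) h1) _.
  rewrite ler_pdivrMr ?expR_gt0//.
  have h2 : (x / 2) ^+ r.+1 / r.+1`!%:R <= expR (x / 2).
    by apply: le_trans (expR_ge1Dxn r _); [rewrite lerDr|rewrite divr_ge0// ltW].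
  have p0 : 0 <= 2 ^+ r.+1 * (r.+1`!%:R / x) :> R by rewrite mulr_ge0 ?exprn_ge0// divr_ge0// ltW.
  apply: le_trans (ler_wpM2l p0 h2).
  rewrite exprMn exprVn [x ^+ r.+1]exprS le_eqVlt; apply/orP; left; apply/eqP.
  clearbody x; field; by rewrite !gt_eqF// ?exprn_gt0 ?ltr0n ?fact_gt0.
- exact: cvg_cst.
- rewrite -[X in _ --> X](mulr0 c); apply: (@cvgM R); first exact: cvg_cst.
  exact: cvg_harmonic.
Qed.

Lemma gauss_int_cst1 (n : nat) : gauss_int n (fun x => x ^+ 0) = fine (nu (gauss_itv n)).
Proof. by rewrite /gauss_int; under eq_Rintegral do rewrite expr0 mul1r. Qed.

Lemma gauss_int_total : (fun n => gauss_int n (fun x => x ^+ 0)) @ \oo --> (1 : R).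
Proof.
under eq_fun do rewrite gauss_int_cst1.
have bigE : \bigcup_n gauss_itv n = setT.
  apply/seteqP; split => // x _; exists (Num.truncn `|x|).+1 => //.
  rewrite /gauss_itv/= in_itv/= -ler_norml ltW//.
  by have /truncn_itv/andP[] : 0 <= `|x| by [].
have := @nondecreasing_cvg_mu _ _ _ nu gauss_itv (fun i => measurable_gauss_itv i).
rewrite bigE => /(_ measurableT) H.
have {H} : (nu \o gauss_itv) @ \oo --> nu setT.
  apply: H => n m nm; apply/subsetPset => x; rewrite /gauss_itv/= !in_itv/= -!ler_norml.
  by move=> /le_trans; apply; rewrite ler_nat.
rewrite probability_setT => h.
exact: (@fine_cvg _ _ _ _ _ _ h).
Qed.

(** The shift to [n.+1] keeps the interval nondegenerate. Integration by parts lowers the exponent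
    by two, so consecutive exponents are carried together. *)
Lemma gauss_gaussian_means : gaussian_means (fun n => gauss_dom n.+1) (fun n => gauss_int n.+1).
Proof.
split; first by move=> n; exact: gauss_is_mean.
have bd r : (fun n => n.+1%:R ^+ r * phi n.+1%:R - (- n.+1%:R) ^+ r * phi (- n.+1%:R)) @ \oo --> (0 : R).
  have -> : (fun n => n.+1%:R ^+ r * phi n.+1%:R - (- n.+1%:R) ^+ r * phi (- n.+1%:R)) =
      (fun n => (1 - (-1) ^+ r) * (n.+1%:R ^+ r * phi n.+1%:R)).
    by apply/funext => n; rewrite !phiE sqrrN exprNn; ring.
  rewrite -[X in _ --> X](mulr0 (1 - (-1) ^+ r : R)); apply: (@cvgM R); first exact: cvg_cst.
  exact: gauss_boundary.
have main r : ((fun n => gauss_int n.+1 (fun x => x ^+ r)) @ \oo --> gauss_moment R r) /\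
   ((fun n => gauss_int n.+1 (fun x => x ^+ r.+1)) @ \oo --> gauss_moment R r.+1).
  elim: r => [|r [IH1 IH2]].
    split; first by have := gauss_int_total; rewrite -cvg_shiftS.
    under eq_fun do rewrite gauss_int_parts mul0r.
    have -> : gauss_moment R 1 = 0 - 0 by rewrite subr0.
    by apply: (@cvgB _ R^o); [exact: cvg_cst|exact: (bd 0%N)].
  split=> //; under eq_fun do rewrite gauss_int_parts.
  have -> : gauss_moment R r.+2 = r.+1%:R * gauss_moment R r - 0 by rewrite subr0.
  apply: (@cvgB _ R^o); last exact: bd.
  by apply: (@cvgM R); [exact: cvg_cst|exact: IH1].
by move=> r; have [] := main r.
Qed.

Definition gauss_cdf (y : R) : R := fine (nu `]-oo, y]).

Lemma gauss_int_step (n : nat) (y : R) :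
  gauss_int n (fun x => (x <= y)%R%:R) = fine (nu (gauss_itv n `&` `]-oo, y])).
Proof.
rewrite /gauss_int /normal_prob -[RHS]/(\int[mu]_(x in gauss_itv n `&` `]-oo, y]) phi x).
rewrite Rintegral_mkcondr; apply: eq_Rintegral => x _.
rewrite patchE mem_setE in_itv/=.
by case: ifP => _; rewrite ?mul1r ?mul0r.
Qed.

Lemma gauss_int_step_le (n : nat) (y : R) :
  gauss_int n (fun x => (x <= y)%R%:R) <= gauss_cdf y.
Proof.
have mIy : measurable (gauss_itv n `&` `]-oo, y]).
  by apply: measurableI; [exact: measurable_gauss_itv|exact: measurable_itv].
rewrite gauss_int_step; apply: fine_le; rewrite ?fin_num_measure//.
by apply: le_measure; rewrite ?inE.
Qed.

(** Truncation loses at most the normal mass outside the interval. *)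
Lemma gauss_int_step_ge (n : nat) (y : R) :
  gauss_cdf y - (1 - gauss_int n (fun x => x ^+ 0)) <= gauss_int n (fun x => (x <= y)%R%:R).
Proof.
have mI := measurable_gauss_itv n.
have mIC : measurable (~` gauss_itv n) by exact: measurableC.
have mIy : measurable (gauss_itv n `&` `]-oo, y]).
  by apply: measurableI => //; exact: measurable_itv.
rewrite gauss_int_step gauss_int_cst1 lerBlDr.
have -> : 1 - fine (nu (gauss_itv n)) = fine (nu (~` gauss_itv n)).
  by rewrite probability_setC// [RHS]fineB ?fin_num_measure//=.
rewrite -fineD ?fin_num_measure//.
apply: fine_le; first exact: fin_num_measure.
  by rewrite fin_numD; apply/andP; split; exact: fin_num_measure.
apply: le_trans (measureU2 _ _ _) => //.
apply: le_measure; rewrite ?inE//; first exact: measurableU.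
by move=> x xy; have [xI|xI] := pselect (gauss_itv n x); [left|right].
Qed.

(** The density never exceeds its peak. This continuity of the limit law is what finally removes the
    shifts of the thresholds. *)
Lemma gauss_cdf_lip (y d : R) : 0 <= d ->
  gauss_cdf (y + d) <= gauss_cdf y + normal_peak 1 * d.
Proof.
move=> d0.
have m1 : measurable (`]-oo, y] : set R) by [].
pose I := [set` `[y, y + d]%R].
have m2 : measurable I by exact: measurable_itv.
have h : (nu I <= (normal_peak 1 * d)%:E)%E.
  apply: (@le_trans _ _ (\int[mu]_(x in I) (normal_peak 1)%:E)%E).
    apply: ge0_le_integral => //.
    - by move=> x _; rewrite lee_fin normal_pdf_ge0.
    - by apply/measurable_EFinP; apply: measurable_funTS; exact: measurable_normal_pdf.
    - by move=> x _; rewrite lee_fin normal_pdf_ub// oner_neq0.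
  have vol : (mu I <= d%:E)%E.
    apply: (@le_trans _ _ (lebesgue_measure [set` `[y, (y + d)%R]])) => //.
    rewrite lebesgue_measure_itv/= lte_fin; case: ltP => _; rewrite ?lee_fin//.
    by rewrite addrAC subrr add0r.
  rewrite integral_cst// EFinM; apply: lee_wpmul2l => //.
  by rewrite lee_fin normal_peak_ge0.
rewrite -lee_fin EFinD /gauss_cdf !fineK ?fin_num_measure//.
apply: (@le_trans _ _ (nu `]-oo, y] + nu I)%E); last by rewrite leeD2l.
apply: le_trans (measureU2 _ _ _) => //.
apply: le_measure; rewrite ?inE//; first exact: measurableU.
move=> x /=; rewrite /I/= !in_itv/= => xyd.
by have [xy|yx] := leP x y; [left|right; rewrite (ltW yx)].
Qed.
End Gauss.

(** * Moment recursion for divisor counts *)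

Section PowerIncrements.
Variable R : realType.

Lemma norm_pow_incr_le (v k : R) (r : nat) : `|k| <= 1 ->
  `|(v + k) ^+ r - v ^+ r| <= `|k| * r%:R * (`|v| + 1) ^+ r.-1.
Proof.
move=> k1; elim: r => [|r IH]; first by rewrite !expr0 subrr normr0 mulr0 mul0r.
have vk : `|v + k| <= `|v| + 1 by apply: (le_trans (ler_normD _ _)); rewrite lerD2l.
have -> : (v + k) ^+ r.+1 - v ^+ r.+1 = (v + k) * ((v + k) ^+ r - v ^+ r) + k * v ^+ r.
  by rewrite !exprS; ring.
apply: (le_trans (ler_normD _ _)); rewrite !normrM normrX /=.
have h1 : `|v + k| * `|(v + k) ^+ r - v ^+ r| <= `|k| * r%:R * (`|v| + 1) ^+ r.
  apply: (le_trans (ler_pM _ _ vk IH)) => //.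
  case: r {IH} => [|r]; first by rewrite /= !mulr0 !mul0r mulr0.
  by rewrite /= exprS mulrCA.
have h2 : `|k| * `|v| ^+ r <= `|k| * (`|v| + 1) ^+ r.
  by rewrite ler_wpM2l// lerXn2r ?nnegrE ?addr_ge0// lerDl.
apply: (le_trans (lerD h1 h2)).
by rewrite -[r.+1%:R]natr1 mulrDr mulrDl mulr1.
Qed.

(** Each induction step multiplies the old error by [v] and adds [k] times a first-order increment;
    the constants close up because [r ^ 2 + r <= (r + 1) ^ 2]. *)
Lemma norm_pow_taylor_le (v k : R) (r : nat) : `|k| <= 1 ->
  `|(v + k) ^+ r - v ^+ r - r%:R * k * v ^+ r.-1| <= k ^+ 2 * r%:R ^+ 2 * (`|v| + 1) ^+ r.-1.
Proof.
move=> k1; elim: r => [|r IH]; first by rewrite !expr0 !mul0r subrr subr0 normr0 expr0n mulr0 mul0r.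
have v1 : 1 <= `|v| + 1 by rewrite lerDr.
have -> : (v + k) ^+ r.+1 - v ^+ r.+1 - r.+1%:R * k * v ^+ r.+1.-1 =
    v * ((v + k) ^+ r - v ^+ r - r%:R * k * v ^+ r.-1) + k * ((v + k) ^+ r - v ^+ r).
  have -> : r.+1%:R * k * v ^+ r.+1.-1 = k * v ^+ r + v * (r%:R * k * v ^+ r.-1).
    case: r {IH} => [|r]; first by rewrite !mul0r mulr0 addr0 mul1r.
    by rewrite /= [v ^+ r.+1]exprS -[r.+2%:R]natr1; ring.
  by rewrite !exprS; ring.
apply: (le_trans (ler_normD _ _)); rewrite !normrM /=.
have h1 : `|v| * `|(v + k) ^+ r - v ^+ r - r%:R * k * v ^+ r.-1| <=
    k ^+ 2 * r%:R ^+ 2 * (`|v| + 1) ^+ r.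
  apply: (@le_trans _ _ ((`|v| + 1) * (k ^+ 2 * r%:R ^+ 2 * (`|v| + 1) ^+ r.-1))).
    by apply: ler_pM => //; rewrite lerDl.
  case: r {IH} => [|r]; first by rewrite !expr0n /= !(mulr0, mul0r).
  by rewrite /= [_ ^+ r.+1 in leRHS]exprS mulrCA.
have h2 : `|k| * `|(v + k) ^+ r - v ^+ r| <= k ^+ 2 * r%:R * (`|v| + 1) ^+ r.
  apply: (le_trans (ler_wpM2l (normr_ge0 _) (norm_pow_incr_le _ _ k1))).
  have kr : 0 <= k ^+ 2 * r%:R by apply: mulr_ge0 => //; exact: sqr_ge0.
  rewrite !mulrA -expr2 real_normK ?num_real//; apply: ler_wpM2l => //.
  by rewrite ler_weXn2l// leq_pred.
apply: (le_trans (lerD h1 h2)); rewrite -mulrDl ler_wpM2r ?exprn_ge0 ?addr_ge0//.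
rewrite -mulrDr ler_wpM2l ?sqr_ge0// -natr1 sqrrD1 -!addrA lerD2l.
by rewrite lerDl addr_ge0.
Qed.

(** Turns an absolute moment into a genuine one. The even exponent is [r - 1] or [r], hence below
    the order [r + 1] at which the recursion uses it. One factor [2 ^+ r./2] comes from
    [(|v| + 1)^2 <= 2 (1 + v^2)], the other from distributing the power over [1 + v^2]. *)
Lemma pow_le_even (v : R) (r : nat) :
  (`|v| + 1) ^+ r.-1 <= 4 ^+ r./2 * (1 + v ^+ (r./2).*2).
Proof.
have v1 : 1 <= `|v| + 1 by rewrite lerDr.
apply: (@le_trans _ _ ((`|v| + 1) ^+ (r./2).*2)); first by rewrite ler_weXn2l//; lia.
move: r./2 => j; rewrite -!mul2n !exprM.
have -> : 4 = 2 * 2 :> R by ring.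
apply: (@le_trans _ _ ((2 * (1 + v ^+ 2)) ^+ j)).
  rewrite lerXn2r ?nnegrE ?sqr_ge0 ?mulr_ge0 ?addr_ge0 ?sqr_ge0//.
  have := sqr_ge0 (`|v| - 1); rewrite -(real_normK (num_real v)) !expr2; nra.
rewrite [(2 * 2) ^+ j]exprMn [(2 * (1 + _)) ^+ j]exprMn -mulrA ler_wpM2l ?exprn_ge0//.
have := sqr_ge0 v; move: (v ^+ 2) => u u0.
elim: j => [|j IH]; first by rewrite !expr0; lra.
have uj : 0 <= u ^+ j by rewrite exprn_ge0.
have p2 : 1 <= 2 ^+ j :> R by rewrite exprn_ege1// ler1n.
have [u1|u1] := leP u 1.
  have : u ^+ j.+1 <= 1 by rewrite exprn_ile1.
  have : 0 <= u ^+ j.+1 by rewrite exprn_ge0.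
  have : (1 + u) ^+ j.+1 <= 2 ^+ j.+1 by rewrite lerXn2r ?nnegrE; lra.
  have : 0 <= 2 ^+ j.+1 :> R by rewrite exprn_ge0.
  by move: (2 ^+ j.+1) => a; nra.
have : (1 + u) ^+ j.+1 <= (2 * u) ^+ j.+1 by rewrite lerXn2r ?nnegrE; lra.
rewrite exprMn; have : 0 <= 2 ^+ j.+1 :> R by rewrite exprn_ge0.
by move: (2 ^+ j.+1) (u ^+ j.+1) => a b; nra.
Qed.
End PowerIncrements.

(** * Nearly independent divisibility indicators under a weight *)

Section DivisorMoments.
Variables (R : realType) (n : nat) (w : nat -> R).
Hypothesis w_ge0 : forall i, (1 <= i <= n)%N -> 0 <= w i.
Hypothesis w_sum1 : \sum_(1 <= i < n.+1) w i = 1.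

Definition avg (f : nat -> R) : R := \sum_(1 <= m < n.+1) w m * f m.

Lemma avg_eq (f g : nat -> R) : (forall m, f m = g m) -> avg f = avg g.
Proof. by move=> fg; apply: eq_bigr => m _; rewrite fg. Qed.

Lemma avgD (f g : nat -> R) : avg (fun m => f m + g m) = avg f + avg g.
Proof. by rewrite /avg -big_split; apply: eq_bigr => m _; rewrite mulrDr. Qed.

Lemma avgZ (a : R) (f : nat -> R) : avg (fun m => a * f m) = a * avg f.
Proof. by rewrite /avg mulr_sumr; apply: eq_bigr => m _; rewrite mulrCA. Qed.

Lemma avgB (f g : nat -> R) : avg (fun m => f m - g m) = avg f - avg g.
Proof. by rewrite /avg -sumrB; apply: eq_bigr => m _; rewrite mulrBr. Qed.

Lemma avg_sum (I : Type) (r : seq I) (Q : pred I) (f : I -> nat -> R) :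
  avg (fun m => \sum_(i <- r | Q i) f i m) = \sum_(i <- r | Q i) avg (f i).
Proof.
by rewrite /avg exchange_big/=; apply: eq_bigr => m _; rewrite mulr_sumr.
Qed.

Lemma avg_le (f g : nat -> R) : (forall m, (1 <= m <= n)%N -> f m <= g m) -> avg f <= avg g.
Proof.
move=> fg; rewrite /avg big_nat [leRHS]big_nat; apply: ler_sum => m mn.
by rewrite ler_wpM2l ?w_ge0 ?fg.
Qed.

Lemma avg_cst (c : R) : avg (fun=> c) = c.
Proof. by rewrite /avg -mulr_suml w_sum1 mul1r. Qed.

Lemma norm_avg_le (f g : nat -> R) : (forall m, `|f m| <= g m) -> `|avg f| <= avg g.
Proof.
move=> fg; rewrite ler_norml -[X in X <= _]mulN1r -avgZ; apply/andP; split; apply: avg_le => m _.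
  by have := fg m; rewrite ler_norml mulN1r => /andP[].
by have := fg m; rewrite ler_norml => /andP[].
Qed.

Definition div_ind (p m : nat) : R := (p %| m)%N%:R.

Definition div_prod (A : seq nat) (m : nat) : R := \prod_(p <- A) div_ind p m.

Lemma div_indK (p m : nat) : div_ind p m * div_ind p m = div_ind p m.
Proof. by rewrite /div_ind; case: (p %| m)%N; rewrite ?mulr1 ?mulr0. Qed.

Variables (s : seq nat) (B : R).
Hypothesis s_uniq : uniq s.
Hypothesis s_gt0 : forall p, p \in s -> (0 < p)%N.
Hypothesis near_indep : forall A, uniq A -> {subset A <= s} ->
  `|avg (div_prod A) - \prod_(p <- A) (p%:R)^-1| <= B.

Local Notation N := (size s)%:R.
Local Notation mu := (\sum_(p <- s) (p%:R)^-1 : R).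
Local Notation sigma2 := (\sum_(p <- s) (p%:R)^-1 * (1 - (p%:R)^-1) : R).

Definition div_count_but (p m : nat) : R := \sum_(q <- s | q != p) div_ind q m.

Lemma inv_prime_itv p : p \in s -> 0 <= (p%:R : R)^-1 <= 1.
Proof. by move=> /s_gt0 p0; rewrite invr_ge0 ler0n/= invf_le1 ?ler1n ?ltr0n. Qed.

(* Expanding one factor of the power multiplies [div_prod A] by some [div_ind q]; as indicators
   are idempotent, this only enlarges the set [A]. *)
Lemma avg_div_decouple (j p : nat) (A : seq nat) (c : R) :
  p \in s -> uniq A -> {subset A <= s} -> p \notin A ->
  `|avg (fun m => div_ind p m * (div_prod A m * (div_count_but p m + c) ^+ j)) -
    (p%:R)^-1 * avg (fun m => div_prod A m * (div_count_but p m + c) ^+ j)|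
    <= 2 * B * (N + `|c|) ^+ j.
Proof.
move=> ps; have /andP[ip0 ip1] := inv_prime_itv ps.
have B0 : 0 <= B by apply: le_trans (near_indep (isT : uniq [::]) _).
elim: j A => [|j IH] A uA As pA.
  under avg_eq do rewrite expr0 mulr1.
  under [X in _ * X]avg_eq do rewrite expr0 mulr1.
  have h1 := near_indep uA As.
  have uA' : uniq (p :: A) by rewrite /= pA.
  have sA' : {subset p :: A <= s} by move=> q; rewrite inE => /orP[/eqP->|/As].
  have := near_indep uA' sA'; rewrite big_cons.
  have -> : avg (div_prod (p :: A)) = avg (fun m => div_ind p m * div_prod A m).
    by apply: avg_eq => m; rewrite /div_prod big_cons.
  move: h1; set a := avg _; set b := avg _; set x := \prod_(_ <- _) _; set q := _^-1 => h1 h2.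
  have -> : b - q * a = (b - q * x) - q * (a - x) by ring.
  rewrite expr0 mulr1; apply: (le_trans (ler_normB _ _)).
  have -> : 2 * B = B + B by ring.
  apply: lerD => //; rewrite normrM (ger0_norm ip0) -[leRHS]mul1r.
  exact: ler_pM.
pose ext q := if q \in A then A else q :: A.
have extE q m : div_prod (ext q) m = div_prod A m * div_ind q m.
  rewrite /ext; case: ifPn => qA; last by rewrite /div_prod big_cons mulrC.
  rewrite /div_prod (big_rem q)//= mulrAC div_indK.
  by [].
have expand m : div_prod A m * (div_count_but p m + c) ^+ j.+1 =
   (\sum_(q <- s | q != p) div_prod (ext q) m * (div_count_but p m + c) ^+ j) +
   c * (div_prod A m * (div_count_but p m + c) ^+ j).
  under eq_bigr => q _ do rewrite extE.
  by rewrite -mulr_suml -mulr_sumr -/(div_count_but p m) exprS; ring.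
have -> : avg (fun m => div_prod A m * (div_count_but p m + c) ^+ j.+1) =
    (\sum_(q <- s | q != p) avg (fun m => div_prod (ext q) m * (div_count_but p m + c) ^+ j)) +
    c * avg (fun m => div_prod A m * (div_count_but p m + c) ^+ j).
  by rewrite (avg_eq expand) avgD avg_sum avgZ.
have -> : avg (fun m => div_ind p m * (div_prod A m * (div_count_but p m + c) ^+ j.+1)) =
    (\sum_(q <- s | q != p) avg (fun m => div_ind p m * (div_prod (ext q) m * (div_count_but p m + c) ^+ j))) +
    c * avg (fun m => div_ind p m * (div_prod A m * (div_count_but p m + c) ^+ j)).
  rewrite -avg_sum -avgZ -avgD; apply: avg_eq => m.
  by rewrite expand mulrDr mulr_sumr mulrCA.
have alg (x y q u v : R) : x + c * u - q * (y + c * v) = x - q * y + c * (u - q * v).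
  by ring.
rewrite alg mulr_sumr -sumrB.
apply: (le_trans (ler_normD _ _)); rewrite exprS mulrCA mulrDl.
apply: lerD; last by rewrite normrM ler_wpM2l// IH.
apply: (le_trans (ler_norm_sum _ _ _)).
apply: (@le_trans _ _ (\sum_(q <- s | q != p) 2 * B * (N + `|c|) ^+ j)).
  rewrite big_seq_cond [leRHS]big_seq_cond; apply: ler_sum => q /andP[qs qp].
  apply: IH.
  - by rewrite /ext; case: ifPn => //= ->.
  - by rewrite /ext; case: ifPn => // qA x; rewrite inE => /orP[/eqP->|/As].
  - by rewrite /ext; case: ifPn => // qA; rewrite inE negb_or eq_sym qp.
have K0 : 0 <= 2 * B * (N + `|c|) ^+ j by rewrite !mulr_ge0// exprn_ge0// addr_ge0.
rewrite big_const_seq iter_addr_0 -[_ *+ count _ _]mulr_natl ler_wpM2r// ler_nat.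
exact: count_size.
Qed.

Definition div_dev (m : nat) : R := \sum_(p <- s) div_ind p m - mu.

Lemma mu_itv : 0 <= mu <= N.
Proof.
rewrite big_seq; apply/andP; split.
  by apply: sumr_ge0 => p /inv_prime_itv /andP[].
apply: (@le_trans _ _ (\sum_(p <- s | p \in s) 1)).
  by apply: ler_sum => p /inv_prime_itv /andP[].
by rewrite -big_seq big_const_seq iter_addr_0 count_predT.
Qed.

Lemma div_dev_but p m : p \in s -> div_dev m = div_ind p m + (div_count_but p m - mu).
Proof. by move=> ps; rewrite /div_dev (bigD1_seq p)//= addrA. Qed.

(** One factor of the power is split into its centered indicators. With [T] the rest of the
    deviation, the power is [(T + 1) ^+ r] when [p] divides [m] and [T ^+ r] otherwise; decoupling
    the indicator from [T] leaves the variance [1/p (1 - 1/p)] times the mean increment. *)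
Lemma avg_dev_pow (r : nat) :
  `|avg (fun m => div_dev m ^+ r.+1) - \sum_(p <- s) (p%:R)^-1 * (1 - (p%:R)^-1) *
     avg (fun m => (div_count_but p m - mu + 1) ^+ r - (div_count_but p m - mu) ^+ r)|
  <= 2 * B * N * (2 * N + 1) ^+ r.
Proof.
have B0 : 0 <= B by apply: le_trans (near_indep (isT : uniq [::]) _).
have /andP[mu0 muN] := mu_itv.
have -> : avg (fun m => div_dev m ^+ r.+1) =
    \sum_(p <- s) avg (fun m => (div_ind p m - (p%:R)^-1) * div_dev m ^+ r).
  rewrite -avg_sum; apply: avg_eq => m.
  by rewrite exprS -mulr_suml sumrB.
rewrite -sumrB; apply: (le_trans (ler_norm_sum _ _ _)).
have -> : 2 * B * N * (2 * N + 1) ^+ r = \sum_(p <- s) (2 * B * (2 * N + 1) ^+ r) :> R.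
  by rewrite big_const_seq iter_addr_0 count_predT -mulr_natl; ring.
rewrite big_seq [leRHS]big_seq; apply: ler_sum => p ps.
have /andP[ip0 ip1] := inv_prime_itv ps.
move: ip0 ip1; set q : R := _^-1; set K : R := 2 * B * _ => ip0 ip1.
(* Used for [c = - mu + 1] and [c = - mu], the two cases of [p] dividing [m] or not; in both
   [N + |c|] is at most [2 N + 1]. *)
have dec c : `|c| <= N + 1 ->
   `|avg (fun m => div_ind p m * (div_count_but p m + c) ^+ r) -
     q * avg (fun m => (div_count_but p m + c) ^+ r)| <= K.
  move=> cN; have := @avg_div_decouple r p [::] c ps isT (fun _ h => False_ind _ (notF h)) isT.
  under avg_eq do rewrite /div_prod big_nil mul1r.
  under [X in _ * X]avg_eq do rewrite /div_prod big_nil mul1r.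
  move=> /le_trans; apply; rewrite ler_wpM2l ?mulr_ge0// lerXn2r ?nnegrE//.
  by lra.
have := dec (- mu + 1); have := dec (- mu).
have mu1 : `|- mu| <= N + 1 by rewrite normrN ger0_norm//; lra.
have mu2 : `|- mu + 1| <= N + 1.
  by rewrite ler_norml; apply/andP; split; have := ler0n R (size s); lra.
move=> /(_ mu1) h1 /(_ mu2) h2.
have -> : avg (fun m => (div_ind p m - q) * div_dev m ^+ r) =
    (1 - q) * avg (fun m => div_ind p m * (div_count_but p m + (- mu + 1)) ^+ r)
    + q * avg (fun m => div_ind p m * (div_count_but p m + - mu) ^+ r)
    - q * avg (fun m => (div_count_but p m + - mu) ^+ r).
  rewrite -!avgZ -avgD -avgB; apply: avg_eq => m; rewrite (div_dev_but m ps) addrA.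
  move: (div_count_but p m) => t; rewrite /div_ind; case: (p %| m)%N.
    rewrite (_ : true%:R = 1 :> R)//.
    have -> : 1 + t - mu = t + (- mu + 1) by ring.
    ring.
  by rewrite (_ : false%:R = 0 :> R)// add0r !mul0r !mulr0 !add0r mulNr.
rewrite avgB.
have -> : avg (fun m => (div_count_but p m - mu + 1) ^+ r) =
   avg (fun m => (div_count_but p m + (- mu + 1)) ^+ r).
  by apply: avg_eq => m; rewrite addrA.
move: h1 h2; set a1 := avg _; set a2 := avg _; set b1 := avg _; set b2 := avg _ => h1 h2.
have -> : (1 - q) * b1 + q * a1 - q * a2 - q * (1 - q) * (b2 - a2) =
   (1 - q) * (b1 - q * b2) + q * (a1 - q * a2) by ring.
have q1 : 0 <= 1 - q by rewrite subr_ge0.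
apply: (le_trans (ler_normD _ _)); rewrite !normrM (ger0_norm ip0) (ger0_norm q1).
apply: (le_trans (lerD (ler_wpM2l q1 h2) (ler_wpM2l ip0 h1))).
by rewrite -mulrDl subrK mul1r.
Qed.

(* Stein's identity [E (V f(V)) = E f'(V)] for [f v = v ^+ r], up to a Taylor error. *)
Lemma moment_recursion (h : R) (r : nat) : 0 <= h <= 1 ->
  `|avg (fun m => (h * div_dev m) ^+ r.+1) -
    r%:R * (h ^+ 2 * sigma2) * avg (fun m => (h * div_dev m) ^+ r.-1)| <=
  h * (h ^+ 2 * sigma2) * (r%:R ^+ 2 * (4 ^+ r./2 * (1 + avg (fun m => (h * div_dev m) ^+ (r./2).*2))))
   + 2 * B * N * (2 * N + 1) ^+ r.
Proof.
move=> /andP[h0 h1].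
have B0 : 0 <= B by apply: le_trans (near_indep (isT : uniq [::]) _).
have hr0 : 0 <= h ^+ r.+1 <= 1 by rewrite exprn_ge0//= exprn_ile1.
have /andP[hr1 hr2] := hr0.
set e2 := 2 * B * N * _.
have e20 : 0 <= e2 by rewrite !mulr_ge0// exprn_ge0// addr_ge0// mulr_ge0.
have -> : avg (fun m => (h * div_dev m) ^+ r.+1) = h ^+ r.+1 * avg (fun m => div_dev m ^+ r.+1).
  by rewrite -avgZ; apply: avg_eq => m; rewrite exprMn.
have := avg_dev_pow r; rewrite -/e2.
set M := avg _; set SS := \sum_(_ <- _) _ => hM.
set G := avg (fun m => (h * div_dev m) ^+ r.-1).
set E2 := avg (fun m => (h * div_dev m) ^+ (r./2).*2).
have -> : h ^+ r.+1 * M - r%:R * (h ^+ 2 * sigma2) * G =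
   h ^+ r.+1 * (M - SS) + (h ^+ r.+1 * SS - r%:R * (h ^+ 2 * sigma2) * G) by ring.
rewrite [leRHS]addrC; apply: (le_trans (ler_normD _ _)); apply: lerD.
  by rewrite normrM ger0_norm// -[leRHS]mul1r ler_pM.
have -> : h ^+ r.+1 * SS - r%:R * (h ^+ 2 * sigma2) * G =
  \sum_(p <- s) (p%:R)^-1 * (1 - (p%:R)^-1) * (h *
     (avg (fun m => (h * (div_count_but p m - mu) + h) ^+ r - (h * (div_count_but p m - mu)) ^+ r
        - r%:R * h * (h * div_dev m) ^+ r.-1))).
  have -> : r%:R * (h ^+ 2 * sigma2) * G = \sum_(p <- s) (p%:R)^-1 * (1 - (p%:R)^-1) * (r%:R * h ^+ 2 * G).
    by rewrite -mulr_suml; ring.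
  rewrite mulr_sumr -sumrB; apply: eq_bigr => p _.
  rewrite [in RHS]avgB avgZ -/G.
  have -> : avg (fun m => (h * (div_count_but p m - mu) + h) ^+ r - (h * (div_count_but p m - mu)) ^+ r)
    = h ^+ r * avg (fun m => (div_count_but p m - mu + 1) ^+ r - (div_count_but p m - mu) ^+ r).
    by rewrite -avgZ; apply: avg_eq => m; move: (div_count_but p m - _) => t; rewrite mulrBr -!exprMn mulrDr mulr1.
  by rewrite exprS expr2; ring.
apply: (le_trans (ler_norm_sum _ _ _)).
have -> : h * (h ^+ 2 * sigma2) * (r%:R ^+ 2 * (4 ^+ r./2 * (1 + E2))) =
  \sum_(p <- s) (p%:R)^-1 * (1 - (p%:R)^-1) * (h * (h ^+ 2 * (r%:R ^+ 2 * (4 ^+ r./2 * (1 + E2))))).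
  by rewrite -mulr_suml; ring.
rewrite big_seq [leRHS]big_seq; apply: ler_sum => p ps.
have /andP[ip0 ip1] := inv_prime_itv ps.
have q1 : 0 <= 1 - (p%:R)^-1 :> R by rewrite subr_ge0.
rewrite normrM ger0_norm ?mulr_ge0// ler_wpM2l ?mulr_ge0//.
rewrite normrM ger0_norm// ler_wpM2l//.
have -> : h ^+ 2 * (r%:R ^+ 2 * (4 ^+ r./2 * (1 + E2))) =
   avg (fun m => h ^+ 2 * r%:R ^+ 2 * (4 ^+ r./2 * (1 + (h * div_dev m) ^+ (r./2).*2))).
  by rewrite 2!avgZ avgD avg_cst -/E2; ring.
apply: norm_avg_le => m.
apply: (@le_trans _ _ (h ^+ 2 * r%:R ^+ 2 * (`|h * div_dev m| + 1) ^+ r.-1)); last first.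
  by rewrite ler_wpM2l ?mulr_ge0 ?sqr_ge0// pow_le_even.
have hn : `|h| <= 1 by rewrite ger0_norm.
rewrite (div_dev_but m ps); set t := div_count_but p m - mu.
(* The increment goes from [h * t] to [h * t + h], and [h * div_dev m] is one of these ends: the
   upper if [p] divides [m], the lower otherwise. Taylor expansion is taken at that end, with step
   [- h] or [h]. *)
rewrite /div_ind; case: (p %| m)%N.
  have := @norm_pow_taylor_le R (h * (1 + t)) (- h) r; rewrite normrN => /(_ hn).
  rewrite sqrrN -normrN; congr (`|_| <= _).
  have -> : h * (1 + t) - h = h * t by ring.
  have -> : h * t + h = h * (1 + t) by ring.
  ring.
by rewrite add0r; exact: norm_pow_taylor_le.
Qed.
End DivisorMoments.

(** * The distributions of the theorem *)

Section Cutoff.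
Variable R : realType.
Local Notation ll n := (ln (ln (n%:R : R))).

(* The threshold [4 <= ll n] of the lemmas below guarantees [2 <= ln (alpha n)] and [2 <= cutoff n]. *)
Definition cutoff (n : nat) : nat := Num.truncn (alpha R n).
Definition small_primes (n : nat) : seq nat := [seq p <- index_iota 0 (cutoff n).+1 | prime p].
Definition ll_scale (n : nat) : R := (Num.sqrt (ll n))^-1.
(** The power [L ^ (-1/4)], a common rate for all errors: it dominates [ln L / sqrt L] as well as
    any fixed power of [alpha n] divided by [n], up to constants. *)
Definition ll_small (n : nat) : R := (Num.sqrt (Num.sqrt (ll n)))^-1.

Lemma loglog_ge_near (M : R) : \forall n \near \oo, M <= ll n.
Proof.
exists (Num.truncn (expR (expR M))).+1 => // n /= hn.
have hn' : expR (expR M) <= n%:R.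
  apply: (@le_trans _ _ ((Num.truncn (expR (expR M))).+1%:R)); last by rewrite ler_nat.
  by rewrite ltW// truncnS_gt.
have h1 : expR M <= ln n%:R.
  by rewrite -[leLHS]expRK ler_ln ?posrE ?expR_gt0// (lt_le_trans _ hn')// expR_gt0.
by rewrite -[leLHS]expRK ler_ln ?posrE ?expR_gt0// (lt_le_trans _ h1)// expR_gt0.
Qed.

Lemma loglog_gt0 (n : nat) : 0 < ll n -> 1 < ln (n%:R : R) /\ (0 < n)%N.
Proof.
move=> l0; have ln1 : 1 < ln (n%:R : R).
  by rewrite ltNge; apply/negP => /ln_le0; rewrite leNgt l0.
split=> //; case: n {l0} ln1 => // /[!ln0]//.
by rewrite ltr10.
Qed.

Lemma ln_alpha (n : nat) : ln (alpha R n) = ln n%:R / ll n.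
Proof. by rewrite /alpha ln_powR mulrC. Qed.

Lemma ln_alpha_ge (n : nat) : 4 <= ll n -> 2 <= ln (alpha R n).
Proof.
move=> l4; have l0 : 0 < ll n by lra.
have [n1 n0] := loglog_gt0 l0.
rewrite ln_alpha ler_pdivlMr//.
have e : expR (ll n) = ln n%:R by rewrite lnK// posrE; lra.
rewrite -e expRK; have := @expR_ge1Dxn R (ll n) 1 (ltW l0).
rewrite expr2; set l := ll n; have -> : 2`!%:R = 2 :> R by [].
move=> h; apply: le_trans h; rewrite -/l in l4 l0; nra.
Qed.

Lemma alpha_gt0 (n : nat) : (0 < n)%N -> 0 < alpha R n.
Proof. by move=> n0; rewrite powR_gt0// ltr0n. Qed.

Lemma cutoff_bounds (n : nat) : 4 <= ll n ->
  [/\ (2 <= cutoff n)%N, (cutoff n)%:R <= alpha R n,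
      alpha R n / 2 <= (cutoff n)%:R, (cutoff n <= n)%N & 3 <= alpha R n].
Proof.
move=> l4; have l0 : 0 < ll n by lra.
have [n1 n0] := loglog_gt0 l0; have a0 := alpha_gt0 n0.
have la := ln_alpha_ge l4.
have a3 : 3 <= alpha R n.
  rewrite -[leRHS]lnK ?posrE//; have := expR_ge1Dx (ln (alpha R n)); lra.
have /truncn_itv/andP[] := ltW a0; rewrite -/(cutoff n) => ka ak.
have k2 : (2 <= cutoff n)%N by rewrite truncn_ge_nat ?(ltW a0)//; lra.
have k2' : 2 <= (cutoff n)%:R :> R by rewrite ler_nat.
split => //; first by move: ak; rewrite -natr1; lra.
rewrite -(ler_nat R); apply: (le_trans ka).
rewrite -ler_ln ?posrE ?ltr0n// ln_alpha ler_pdivrMr//; nra.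
Qed.

(** The iterated logarithm of [alpha n] is exactly [L - ln L]. Rounding down at most halves
    [alpha n], hence at most halves its logarithm, which is at least 2; this is the loss of
    [ln 2]. *)
Lemma loglog_cutoff (n : nat) : 4 <= ll n ->
  ll n - ln (ll n) - ln 2 <= ll (cutoff n) <= ll n - ln (ll n).
Proof.
move=> l4; have l0 : 0 < ll n by lra.
have [n1 n0] := loglog_gt0 l0; have a0 := alpha_gt0 n0.
have la := ln_alpha_ge l4; have [k2 ka ak kn a3] := cutoff_bounds l4.
have k2' : 2 <= (cutoff n)%:R :> R by rewrite ler_nat.
have l2 : ln 2 <= 1 :> R by have := @ln_le_sub1 R 2; lra.
have e : ll n - ln (ll n) = ln (ln (alpha R n)).
  by rewrite ln_alpha ln_div// posrE; lra.
have lk0 : 0 < ln ((cutoff n)%:R : R) by rewrite ln_gt0//; lra.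
rewrite e -ln_div ?posrE; [|lra|lra].
apply/andP; split; (rewrite ler_ln ?posrE; [|lra|lra]).
  apply: (@le_trans _ _ (ln (alpha R n / 2))); last by rewrite ler_ln ?posrE; lra.
  by rewrite ln_div ?posrE; lra.
by rewrite ler_ln ?posrE; lra.
Qed.

Lemma mertens_cutoff : exists2 C : R, 0 <= C & forall n, 4 <= ll n ->
  `|prime_recip_sum R (cutoff n) - ll n| <= C + ln (ll n) /\
  prime_recip_sum R n - prime_recip_sum R (cutoff n) <= C + ln (ll n).
Proof.
have [C hC] := mertens_second R.
have C0 : 0 <= C by apply: le_trans (hC 2%N isT).
exists (2 * C + 1) => [|n l4]; first by lra.
have [k2 ka ak kn a3] := cutoff_bounds l4.
have := hC _ k2; have := hC n (leq_trans k2 kn).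
have /andP[] := loglog_cutoff l4.
have l2 : ln 2 <= 1 :> R by have := @ln_le_sub1 R 2; lra.
have l20 : 0 <= ln 2 :> R by rewrite ln_ge0//; lra.
have ll0 : 0 <= ln (ll n) by rewrite ln_ge0//; lra.
rewrite !ler_norml => ? ? /andP[? ?] /andP[? ?]; split; last by lra.
by apply/andP; split; lra.
Qed.

Lemma ll_small_itv (n : nat) : 4 <= ll n -> 0 < ll_small n <= 1.
Proof.
move=> l4; have sqrt1 (x : R) : 1 <= x -> 1 <= Num.sqrt x.
  by move=> x1; rewrite -[leLHS](@sqrtr1 R) ler_wsqrtr.
have h1 : 1 <= Num.sqrt (Num.sqrt (ll n)) by apply/sqrt1/sqrt1; lra.
by rewrite invr_gt0 (lt_le_trans ltr01 h1)/= invf_le1// (lt_le_trans ltr01 h1).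
Qed.

Lemma ll_small_scale (n : nat) : 0 <= ll n -> ll_scale n = ll_small n ^+ 2.
Proof. by move=> l0; rewrite /ll_scale /ll_small exprVn sqr_sqrtr// sqrtr_ge0. Qed.

Lemma ll_scale_sq (n : nat) : 0 <= ll n -> ll_scale n ^+ 2 = (ll n)^-1.
Proof. by move=> l0; rewrite /ll_scale exprVn sqr_sqrtr. Qed.

(** Writing [ln L] as four times the logarithm of the fourth root of [L] bounds it by four times
    that root. *)
Lemma lnll_le (n : nat) (C : R) : 4 <= ll n -> 0 <= C ->
  (C + ln (ll n)) * ll_scale n <= (C + 4) * ll_small n.
Proof.
move=> l4 C0; have /andP[g0 g1] := ll_small_itv l4.
have l0 : 0 <= ll n by lra.
rewrite (ll_small_scale l0).
have -> : ln (ll n) = ln (ll_small n) *- 4.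
  rewrite -lnXn// -lnV ?posrE ?exprn_gt0//; congr ln.
  by rewrite -[4%N]/(2 * 2)%N exprM -ll_small_scale// ll_scale_sq// invrK.
have gi : 0 < (ll_small n)^-1 by rewrite invr_gt0.
have : ln (ll_small n)^-1 < (ll_small n)^-1 by exact: ln_sublinear.
rewrite lnV ?posrE// -mulr_natl.
move: (ln _) => x; have e : ll_small n * (ll_small n)^-1 = 1 by rewrite mulfV ?gt_eqF.
move: (ll_small n) (ll_small n)^-1 g0 g1 e gi => g y g0 g1 e y0 xy.
rewrite expr2 mulrA ler_pM2r//.
have : - x * g <= 1 by rewrite -e mulrC ler_wpM2l ?ltW//.
nra.
Qed.

Lemma ll_small_cvg0 : ll_small @ \oo --> (0 : R).
Proof.
apply/cvgrPdist_le => e e0; near=> n.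
have l4 : 4 <= ll n by near: n; exact: loglog_ge_near.
have /andP[g0 g1] := ll_small_itv l4.
rewrite sub0r normrN gtr0_norm//.
have h : (e^-1 ^+ 2) ^+ 2 <= ll n by near: n; exact: loglog_ge_near.
have ei : 0 < e^-1 by rewrite invr_gt0.
rewrite /ll_small -[leRHS]invrK lef_pV2 ?posrE//; last by rewrite -invr_gt0.
rewrite -[leLHS](ger0_norm (ltW ei)) -sqrtr_sqr ler_wsqrtr//.
by rewrite -[leLHS](ger0_norm (sqr_ge0 _)) -sqrtr_sqr ler_wsqrtr.
Unshelve. all: by end_near. Qed.

Lemma cvg0_ll_small (u : nat -> R) (c : R) :
  (\forall n \near \oo, `|u n| <= c * ll_small n) -> u @ \oo --> (0 : R).
Proof.
move=> h; apply: norm_cvg0; apply: (@squeeze_cvgr _ \oo _ R (cst 0) (fun n => c * ll_small n)).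
- by near=> n; rewrite /= normr_ge0/=; near: n.
- exact: cvg_cst.
- by rewrite -[X in _ --> X](mulr0 c); apply: (@cvgM R); [exact: cvg_cst|exact: ll_small_cvg0].
Unshelve. all: by end_near. Qed.

Lemma small_primesP (n p : nat) : 0 <= alpha R n ->
  (p \in small_primes n) = prime p && (p%:R <= alpha R n).
Proof.
move=> a0; rewrite mem_filter mem_index_iota/= ltnS truncn_ge_nat//.
Qed.

Lemma small_primes_sum (n : nat) :
  \sum_(p <- small_primes n) (p%:R)^-1 = prime_recip_sum R (cutoff n).
Proof. by rewrite big_filter. Qed.

Lemma size_small_primes (n : nat) : 4 <= ll n -> (size (small_primes n))%:R <= 2 * alpha R n.
Proof.
move=> l4; have [k2 ka ak kn a3] := cutoff_bounds l4.
apply: (@le_trans _ _ (cutoff n).+1%:R); last by rewrite -natr1; lra.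
by rewrite ler_nat size_filter (leq_trans (count_size _ _))// size_iota subn0.
Qed.

(** Since [alpha n ^ k = n ^ (k / L)], this power is at most [sqrt n] once [2 k <= L]; and
    [1 / sqrt n <= 2 / L]. *)
Lemma alpha_pow_le (n k : nat) : 4 <= ll n -> 2 * k%:R <= ll n ->
  alpha R n ^+ k / n%:R <= 2 * ll_small n.
Proof.
move=> l4 lk; have l0 : 0 < ll n by lra.
have [n1 n0] := loglog_gt0 l0; have a0 := alpha_gt0 n0.
have n0' : 0 < n%:R :> R by rewrite ltr0n.
set x := ln (n%:R : R).
have h1 : alpha R n ^+ k <= expR (x / 2).
  rewrite -[alpha R n ^+ k]lnK ?posrE ?exprn_gt0// ler_expR lnXn// ln_alpha -/x.
  rewrite -[_ *+ k]mulr_natl mulrA ler_pdivrMr//.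
  have x0 : 0 <= x by move: n1; rewrite -/x; lra.
  by have := ler_wpM2l x0 lk; rewrite -/x; move: (ln x) (k%:R : R) => lx kk; lra.
have h2 : n%:R = expR (x / 2) * expR (x / 2).
  by rewrite -expRD -splitr lnK ?posrE.
have ex0 : 0 < expR (x / 2) by exact: expR_gt0.
apply: (@le_trans _ _ (expR (x / 2))^-1).
  by rewrite ler_pdivrMr// h2 mulKf ?gt_eqF.
have h3 : x / 2 <= expR (x / 2) by have := expR_ge1Dx (x / 2); lra.
have x0 : 0 < x by move: n1; rewrite -/x; lra.
have h4 : ll n <= x by rewrite ltW// ln_sublinear.
have h5 : (ll n)^-1 <= ll_small n.
  rewrite -ll_scale_sq ?(ltW l0)// ll_small_scale ?(ltW l0)// -exprM.
  by have /andP[g0 g1] := ll_small_itv l4; rewrite -[leRHS]expr1 ler_wiXn2l// ltW.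
apply: (@le_trans _ _ (2 * (ll n)^-1)); last by rewrite ler_pM2l.
have -> : 2 * (ll n)^-1 = (ll n / 2)^-1 by rewrite invf_div.
by rewrite lef_pV2 ?posrE//; lra.
Qed.
End Cutoff.

(** * Moments of the number of small prime divisors *)

Section Distribution.
Variables (R : realType) (P : nat -> nat -> R).
Hypothesis HP : forall n : nat, (1 <= n)%N -> is_distrib_on P n.
Local Notation ll n := (ln (ln (n%:R : R))).

Lemma P_ge0 n i : (1 <= i <= n)%N -> 0 <= P n i.
Proof.
by move=> /[dup] /andP[i1 ile]; have [+ _] := HP (leq_trans i1 ile); apply.
Qed.

Lemma sum_multiples (F : nat -> R) (n d : nat) : (0 < d)%N ->
  \sum_(1 <= m < n.+1) F m * (d %| m)%N%:R = \sum_(1 <= l < (n %/ d).+1) F (l * d)%N.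
Proof.
move=> d0; elim: n => [|n IH]; first by rewrite div0n !big_geq.
rewrite big_nat_recr//= IH divnS//.
case: (boolP (d %| n.+1)%N) => dn; last by rewrite mulr0 addr0.
rewrite add1n [RHS]big_nat_recr//= mulr1; congr (_ + F _).
by rewrite -[LHS](divnK dn) divnS// dn.
Qed.

(** The uniform law gives the multiples of [d] the mass [(n %/ d) / n]; [Ssum] is the deviation from
    it. Conditions (ii) and (iii) become bounds on probabilities of divisibility in this way. *)
Lemma avg_dvd (n d : nat) : (0 < d)%N ->
  avg n (P n) (fun m => (d %| m)%N%:R) = Ssum P n d + (n %/ d)%N%:R / n%:R.
Proof.
move=> d0; rewrite /avg sum_multiples// /Ssum sumrB [X in _ - X]big_const_nat.
rewrite iter_addr_0 subSS subn0 mulr_natl.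
by rewrite subrK.
Qed.

Lemma div_prodE (A : seq nat) (m : nat) : uniq A -> all prime A ->
  div_prod R A m = (\prod_(p <- A) p %| m)%N%:R.
Proof.
move=> uA pA; rewrite prime_prod_dvdn// /div_prod.
elim: A {uA pA} => [|p A IH]; first by rewrite big_nil.
by rewrite big_cons IH /= /div_ind; case: (p %| m)%N; rewrite ?mul1r ?mul0r.
Qed.

Variable D : R.
Hypothesis Hiii : forall n : nat, 0 < ll n ->
  forall s : seq nat, distinct_primes s ->
  all (fun p : nat => p%:R <= alpha R n) s ->
  0 <= Ssum P n (\prod_(p <- s) p)%N <= D / n%:R.

Lemma small_primes_near_indep (n : nat) : 4 <= ll n ->
  forall A : seq nat, uniq A -> {subset A <= small_primes R n} ->
  `|avg n (P n) (div_prod R A) - \prod_(p <- A) (p%:R)^-1| <= (1 + `|D|) / n%:R.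
Proof.
move=> l4 A uA As; have l0 : 0 < ll n by lra.
have [n1 n0] := loglog_gt0 l0; have a0 := alpha_gt0 R n0.
have n0' : 0 < n%:R :> R by rewrite ltr0n.
have pA : all prime A.
  by apply/allP => p /As; rewrite small_primesP ?(ltW a0)// => /andP[].
have aA : all (fun p : nat => p%:R <= alpha R n) A.
  by apply/allP => p /As; rewrite small_primesP ?(ltW a0)// => /andP[].
(* [distinct_primes] excludes the empty list; its product is 1 and the total mass settles this case.
   For the others the bound adds the [1/n] of the floor to the [D/n] of (iii). *)
have [->|A0] := eqVneq A [::].
  rewrite big_nil (@avg_eq _ n (P n) _ (fun=> 1)); last by move=> m; rewrite /div_prod big_nil.
  rewrite avg_cst ?subrr ?normr0 ?divr_ge0//.
  by have [] := HP n0.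
set d := (\prod_(p <- A) p)%N.
have d0 : (0 < d)%N.
  rewrite /d big_seq; apply: prodn_cond_gt0 => p /(allP pA); exact: prime_gt0.
have d0' : 0 < d%:R :> R by rewrite ltr0n.
have -> : \prod_(p <- A) (p%:R)^-1 = (d%:R)^-1 :> R.
  by rewrite /d natr_prod prodfV.
rewrite (avg_eq n (P n) (fun m => div_prodE m uA pA)) -/d avg_dvd//.
have dp : distinct_primes A by rewrite /distinct_primes A0 uA.
have /andP[S0 S1] := Hiii l0 dp aA.
rewrite -/d in S0 S1.
have q1 : (n %/ d)%N%:R / n%:R <= (d%:R)^-1 :> R.
  by rewrite ler_pdivrMr// mulrC ler_pdivlMr// -natrM ler_nat leq_divM.
have q2 : (d%:R)^-1 - (n%:R)^-1 <= (n %/ d)%N%:R / n%:R :> R.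
  rewrite ler_pdivlMr// mulrBl mulVf ?gt_eqF// mulrC lerBlDr natr1 ler_pdivrMr//.
  by rewrite -natrM ler_nat ltnW// ltn_ceil.
have D1 : D / n%:R <= `|D| / n%:R by rewrite ler_pM2r ?invr_gt0// ler_norm.
have D2 : 0 <= `|D| / n%:R by rewrite divr_ge0.
have i0 : 0 < (n%:R)^-1 :> R by rewrite invr_gt0.
rewrite mulrDl mul1r.
by rewrite ler_norml; apply/andP; split; lra.
Qed.

Definition norm_dev (n m : nat) : R := ll_scale R n * div_dev R (small_primes R n) m.

Local Notation sigma2 n := (\sum_(p <- small_primes R n) (p%:R)^-1 * (1 - (p%:R)^-1) : R).

Lemma sum_inv_sqr_le (n : nat) : \sum_(1 <= k < n.+1) (k%:R ^- 2 : R) <= 2.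
Proof.
suff H : \sum_(1 <= k < n.+2) (k%:R ^- 2 : R) <= 2 - (n.+1%:R)^-1.
  case: n H => [|n] H; first by rewrite big_geq.
  apply: (@le_trans _ _ (\sum_(1 <= k < n.+3) (k%:R ^- 2 : R))).
    by rewrite [leRHS]big_nat_recr//= lerDl invr_ge0 exprn_ge0.
  by apply: (le_trans H); rewrite lerBlDr lerDl invr_ge0.
elim: n => [|n IH]; first by rewrite big_nat1 expr1n invr1; lra.
rewrite big_nat_recr//=; apply: (le_trans (lerD IH (le_refl _))).
rewrite -(natr1 n.+1); set x : R := n.+1%:R; have x1 : 1 <= x by rewrite ler1n.
have : (x + 1) ^- 2 <= (x * (x + 1))^-1.
  by rewrite lef_pV2 ?posrE ?expr2; nra.
have -> : (x * (x + 1))^-1 = x^-1 - (x + 1)^-1 by field; apply/andP; split; lra.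
by move: (x^-1) ((x + 1)^-1) (_ ^- 2) => a b c; lra.
Qed.

(** The variance differs from the sum of reciprocals by the sum of [1 / p ^ 2], at most 2, and the
    sum of reciprocals is [L + O(ln L)]. *)
Lemma variance_near_one : (fun n => ll_scale R n ^+ 2 * sigma2 n) @ \oo --> (1 : R).
Proof.
have [C C0 hC] := mertens_cutoff R.
have -> : (fun n => ll_scale R n ^+ 2 * sigma2 n) =
    (fun n => (ll_scale R n ^+ 2 * sigma2 n - 1) + 1) by apply/funext => n; rewrite subrK.
rewrite -[X in _ --> X]add0r; apply: (@cvgD _ R^o); last exact: cvg_cst.
apply: (@cvg0_ll_small _ _ (C + 2 + 4)); near=> n.
have l4 : 4 <= ll n by near: n; exact: loglog_ge_near.
have l0 : 0 < ll n by lra.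
have [h1 _] := hC n l4.
have C2 : 0 <= C + 2 by lra.
apply: le_trans (lnll_le l4 C2).
have s2 : `|sigma2 n - prime_recip_sum R (cutoff R n)| <= 2.
  have -> : sigma2 n - prime_recip_sum R (cutoff R n) = - \sum_(p <- small_primes R n) (p%:R ^- 2).
    rewrite -small_primes_sum -sumrB -sumrN; apply: eq_bigr => p _.
    by rewrite -exprVn expr2; ring.
  rewrite normrN ger0_norm; last by apply: sumr_ge0 => p _; rewrite invr_ge0 exprn_ge0.
  apply: le_trans (sum_inv_sqr_le (cutoff R n)).
  rewrite big_filter big_ltn_cond//= big_mkcond/=; apply: ler_sum => p _.
  by case: ifP => _ //; rewrite invr_ge0 exprn_ge0.
have s3 : `|sigma2 n - ll n| <= C + 2 + ln (ll n).
  have -> : sigma2 n - ll n = (sigma2 n - prime_recip_sum R (cutoff R n)) +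
      (prime_recip_sum R (cutoff R n) - ll n) by ring.
  by apply: (le_trans (ler_normD _ _)); lra.
have -> : ll_scale R n ^+ 2 * sigma2 n - 1 = ll_scale R n ^+ 2 * (sigma2 n - ll n).
  by rewrite mulrBr ll_scale_sq ?(ltW l0)// mulVf// gt_eqF.
have /andP[g0 g1] := ll_small_itv l4.
have hs : ll_scale R n = ll_small R n ^+ 2 by rewrite ll_small_scale// ltW.
have h0 : 0 <= ll_scale R n by rewrite hs sqr_ge0.
have hs1 : ll_scale R n <= 1 by rewrite hs exprn_ile1// ltW.
rewrite normrM normrX (ger0_norm h0) mulrC; apply: ler_pM => //; first by rewrite exprn_ge0.
by rewrite expr2 ler_piMr.
Unshelve. all: by end_near. Qed.

(** Strong induction on the order: the recursion for [r + 1] calls on the orders [r - 1] and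
    [2 * (r / 2)]. Its Taylor error carries the scale [1 / sqrt L], and its decoupling error is a
    power of [alpha n] over [n]. *)
Lemma norm_dev_moments (r : nat) :
  (fun n => avg n (P n) (fun m => norm_dev n m ^+ r)) @ \oo --> gauss_moment R r.
Proof.
elim/ltn_ind: r => -[|r] IH.
  apply: (@cvg_trans _ ((fun=> 1 : R) @ \oo)); last exact: cvg_cst.
  apply: near_eq_cvg; exists 1%N => // n /= n1.
  rewrite (@avg_eq _ n (P n) _ (fun=> 1)) => [|m]; last by rewrite expr0.
  by rewrite avg_cst//; have [] := HP n1.
pose a n := avg n (P n) (fun m => norm_dev n m ^+ r.-1).
pose b n := avg n (P n) (fun m => norm_dev n m ^+ (r./2).*2).
pose q n := ll_scale R n ^+ 2 * sigma2 n.
have ca : a @ \oo --> gauss_moment R r.-1 by apply: IH; lia.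
have cb : b @ \oo --> gauss_moment R (r./2).*2 by apply: IH; lia.
have cq : q @ \oo --> (1 : R) := variance_near_one.
pose c1 : R := r%:R ^+ 2 * 4 ^+ r./2.
(* There are [N <= 2 * alpha n] primes and [2 N + 1 <= 5 * alpha n], whence [5 ^+ r.+1]; the last 2
   comes from [alpha_pow_le]. *)
pose c2 : R := 2 * (1 + `|D|) * 5 ^+ r.+1 * 2.
have main : \forall n \near \oo,
   `|avg n (P n) (fun m => norm_dev n m ^+ r.+1) - r%:R * q n * a n| <=
   ll_small R n * (q n * (c1 * (1 + b n))) + c2 * ll_small R n.
  near=> n.
  have l4 : 4 <= ll n by near: n; exact: loglog_ge_near.
  have lr : 2 * r.+1%:R <= ll n by near: n; exact: loglog_ge_near.
  have l0 : 0 < ll n by lra.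
  have [n1 n0] := loglog_gt0 l0; have al0 := alpha_gt0 R n0.
  have n0' : 0 < n%:R :> R by rewrite ltr0n.
  have /andP[g0 g1] := ll_small_itv l4.
  have hs : ll_scale R n = ll_small R n ^+ 2 by rewrite ll_small_scale// ltW.
  have h0 : 0 <= ll_scale R n by rewrite hs sqr_ge0.
  have hsg : ll_scale R n <= ll_small R n.
    by rewrite hs -[leRHS]expr1 ler_wiXn2l// ltW.
  have h01 : 0 <= ll_scale R n <= 1 by rewrite h0 (le_trans hsg).
  have us : uniq (small_primes R n) by rewrite filter_uniq// iota_uniq.
  have ps p : p \in small_primes R n -> (0 < p)%N.
    by rewrite small_primesP ?(ltW al0)// => /andP[/prime_gt0].
  have := @moment_recursion R n (P n) (@P_ge0 n) (HP n0).2 _ _ us ps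
     (small_primes_near_indep l4) _ r h01.
  rewrite -/(q n) => /le_trans; apply; apply: lerD.
    have -> : (r%:R ^+ 2 * (4 ^+ r./2 * (1 + b n))) = c1 * (1 + b n) by rewrite /c1; ring.
    rewrite -mulrA ler_wpM2r//.
    have q0 : 0 <= q n.
      rewrite mulr_ge0 ?sqr_ge0// big_seq; apply: sumr_ge0 => p /ps p0.
      by rewrite mulr_ge0 ?invr_ge0// subr_ge0 invf_le1 ?ler1n ?ltr0n.
    have b0 : 0 <= b n.
      rewrite /b -(avg_cst (HP n0).2 0); apply: avg_le => [i|m _]; first exact: P_ge0.
      by rewrite -mul2n exprM exprn_ge0// sqr_ge0.
    have c10 : 0 <= c1 by rewrite /c1 mulr_ge0 ?exprn_ge0.
    by apply: mulr_ge0 => //; apply: mulr_ge0 => //; exact: addr_ge0.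
  set N : R := (size _)%:R; have N0 : 0 <= N by [].
  have a3 : 3 <= alpha R n by have [] := cutoff_bounds l4.
  have Na : N <= 2 * alpha R n := size_small_primes l4.
  have K0 : 0 <= (1 + `|D|) / n%:R by rewrite divr_ge0// addr_ge0.
  have e1 : N * (2 * N + 1) ^+ r <= (5 * alpha R n) ^+ r.+1.
    rewrite exprS; apply: ler_pM => //; first by rewrite exprn_ge0//; lra.
      lra.
    by rewrite lerXn2r ?nnegrE//; lra.
  apply: (@le_trans _ _ (2 * ((1 + `|D|) / n%:R) * (5 * alpha R n) ^+ r.+1)).
    by rewrite -mulrA ler_wpM2l// mulr_ge0.
  have e2 := alpha_pow_le l4 lr.
  have -> : 2 * ((1 + `|D|) / n%:R) * (5 * alpha R n) ^+ r.+1 =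
     2 * (1 + `|D|) * 5 ^+ r.+1 * (alpha R n ^+ r.+1 / n%:R).
    by rewrite exprMn; ring.
  rewrite /c2 -[leRHS]mulrA; apply: ler_wpM2l; last exact: e2.
  by apply: mulr_ge0; [apply: mulr_ge0 => //; exact: addr_ge0|exact: exprn_ge0].
have cE : (fun n => ll_small R n * (q n * (c1 * (1 + b n))) + c2 * ll_small R n) @ \oo --> (0 : R).
  have -> : (0 : R) = 0 * (1 * (c1 * (1 + gauss_moment R (r./2).*2))) + c2 * 0 by ring.
  apply: (@cvgD _ R^o); last by apply: (@cvgM R); [exact: cvg_cst|exact: ll_small_cvg0].
  apply: (@cvgM R); first exact: ll_small_cvg0.
  apply: (@cvgM R) => //; apply: (@cvgM R); first exact: cvg_cst.
  by apply: (@cvgD _ R^o) => //; exact: cvg_cst.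
have cd : (fun n => avg n (P n) (fun m => norm_dev n m ^+ r.+1) - r%:R * q n * a n) @ \oo --> (0 : R).
  apply: norm_cvg0; apply: (@squeeze_cvgr _ \oo _ R (cst 0) _ _ _ _ _ cE); last exact: cvg_cst.
  by near=> n; rewrite /= normr_ge0/=; near: n.
have -> : (fun n => avg n (P n) (fun m => norm_dev n m ^+ r.+1)) =
   (fun n => (avg n (P n) (fun m => norm_dev n m ^+ r.+1) - r%:R * q n * a n) + r%:R * q n * a n).
  by apply/funext => n; rewrite subrK.
(* At [r = 0] the factor [r%:R] cancels the default exponent [r.-1] and leaves the vanishing first
   moment. *)
have -> : gauss_moment R r.+1 = 0 + r%:R * 1 * gauss_moment R r.-1.
  by case: (r) => [|r'] /=; rewrite ?mul0r ?addr0// mulr1 add0r.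
apply: (@cvgD _ R^o) => //; apply: (@cvgM R) => //.
by apply: (@cvgM R) => //; exact: cvg_cst.
Unshelve. all: by end_near. Qed.

Definition dev_dom (n : nat) (f : R -> R) : Prop := True.
Definition dev_mean (n : nat) (f : R -> R) : R := avg n (P n) (fun m => f (norm_dev n m)).

Lemma dev_gaussian_means : gaussian_means dev_dom dev_mean.
Proof.
split; last exact: norm_dev_moments.
move=> n; split => //.
- by move=> a f g _ _; rewrite /dev_mean avgD avgZ.
- by move=> f g _ _ fg; apply: avg_le => [i|m _]; [exact: P_ge0|exact: fg].
Qed.
End Distribution.

(** * Large primes and passage to the limit *)

Section LargePrimes.
Variables (R : realType) (P : nat -> nat -> R).
Hypothesis HP : forall n : nat, (1 <= n)%N -> is_distrib_on P n.
Local Notation ll n := (ln (ln (n%:R : R))).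
Variable C : R.
Hypothesis Hii : forall n : nat, 0 < ll n ->
  forall p : nat, prime p -> alpha R n < p%:R -> Ssum P n p <= C / p%:R.

Definition norm_omega (n m : nat) : R := ((omega m)%:R - ll n) * ll_scale R n.

Lemma omega_sum (n m : nat) : (1 <= m <= n)%N ->
  (omega m)%:R = \sum_(0 <= p < n.+1 | prime p) div_ind R p m.
Proof.
move=> /andP[m0 mn].
have -> : omega m = (\sum_(0 <= p < n.+1 | prime p) (p %| m))%N.
  rewrite /omega -sum1_size -[RHS]big_filter /= -[in RHS]big_mkcond/= -[RHS]big_filter -filter_predI.
  apply: perm_big; apply: uniq_perm; rewrite ?primes_uniq ?filter_uniq ?iota_uniq//.
  move=> p; rewrite mem_primes mem_filter mem_iota /= m0 add1n ltnS /=.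
  case: (boolP (prime p)) => pp; rewrite ?andbF//= andbT.
  by case: (boolP (p %| m)%N) => //= pm; rewrite prime_gt0// (leq_trans (dvdn_leq m0 pm) mn).
by rewrite natr_sum.
Qed.

(** By (ii) a prime beyond the cutoff divides the random integer with probability at most
    [(1 + |C|) / p]. *)
Lemma avg_large_primes (n : nat) : 4 <= ll n ->
  avg n (P n) (fun m => \sum_((cutoff R n).+1 <= p < n.+1 | prime p) div_ind R p m) <=
  (1 + `|C|) * (prime_recip_sum R n - prime_recip_sum R (cutoff R n)).
Proof.
move=> l4; have l0 : 0 < ll n by lra.
have [n1 n0] := loglog_gt0 l0; have a0 := alpha_gt0 R n0.
have n0' : 0 < n%:R :> R by rewrite ltr0n.
have [k2 ka ak kn a3] := cutoff_bounds l4.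
have -> : prime_recip_sum R n - prime_recip_sum R (cutoff R n) =
    \sum_((cutoff R n).+1 <= p < n.+1 | prime p) (p%:R)^-1.
  by rewrite /prime_recip_sum (big_cat_nat (n := (cutoff R n).+1))//= addrAC subrr add0r.
rewrite avg_sum mulr_sumr big_seq_cond [leRHS]big_seq_cond; apply: ler_sum => p.
rewrite mem_index_iota => /andP[/andP[kp _] pp].
have p0 := prime_gt0 pp.
have p0' : 0 < p%:R :> R by rewrite ltr0n.
have ap : alpha R n < p%:R.
  by rewrite -truncn_lt_nat ?(ltW a0).
rewrite /div_ind avg_dvd//.
have q1 : (n %/ p)%N%:R / n%:R <= (p%:R)^-1 :> R.
  by rewrite ler_pdivrMr// mulrC ler_pdivlMr// -natrM ler_nat leq_divM.
have C1 : C / p%:R <= `|C| / p%:R by rewrite ler_pM2r ?invr_gt0// ler_norm.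
have := Hii l0 pp ap; rewrite mulrDl mul1r; lra.
Qed.

(** Before scaling, the difference is the number of large prime divisors plus the deterministic
    [mu - L]. Both have size [O(ln L)] in mean, with factors [1 + |C|] and 1, hence [2 + |C|]. *)
Lemma norm_omega_dev : exists2 c : R, 0 <= c & forall n, 4 <= ll n ->
  avg n (P n) (fun m => `|norm_omega n m - norm_dev R n m|) <= c * ll_small R n.
Proof.
have [c c0 hc] := mertens_cutoff R.
have C1 : 1 <= 1 + `|C| by rewrite lerDl.
exists ((2 + `|C|) * (c + 4)) => [|n l4]; first by rewrite mulr_ge0; lra.
have l0 : 0 < ll n by lra.
have [n1 n0] := loglog_gt0 l0.
have [h1 h2] := hc n l4.
have [k2 ka ak kn a3] := cutoff_bounds l4.
have h0 : 0 <= ll_scale R n by rewrite ll_small_scale ?(ltW l0)// sqr_ge0.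
have wp := @P_ge0 R P HP n.
pose T (m : nat) : R := \sum_((cutoff R n).+1 <= p < n.+1 | prime p) div_ind R p m.
have T0 m : 0 <= T m by apply: sumr_ge0 => p _; rewrite /div_ind ler0n.
apply: (@le_trans _ _ (avg n (P n) (fun m => ll_scale R n * T m +
    ll_scale R n * `|prime_recip_sum R (cutoff R n) - ll n|))).
  apply: avg_le => // m mn.
  have -> : norm_omega n m - norm_dev R n m =
     ll_scale R n * (T m + (prime_recip_sum R (cutoff R n) - ll n)).
    rewrite /norm_omega /norm_dev /div_dev (omega_sum mn) small_primes_sum big_filter /T.
    rewrite (big_cat_nat (n := (cutoff R n).+1))//=.
    by move: (\sum_(0 <= _ < _ | _) _) (\sum_(_.+1 <= _ < _ | _) _) => u v; ring.
  rewrite -mulrDr normrM (ger0_norm h0) ler_wpM2l//.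
  by apply: (le_trans (ler_normD _ _)); rewrite ger0_norm.
rewrite avgD avgZ avg_cst; last by have [] := HP n0.
have h3 := avg_large_primes l4; rewrite -/(T _) in h3.
have h4 : (1 + `|C|) * (prime_recip_sum R n - prime_recip_sum R (cutoff R n)) <=
   (1 + `|C|) * (c + ln (ll n)) by rewrite ler_wpM2l//; lra.
apply: (@le_trans _ _ ((2 + `|C|) * ((c + ln (ll n)) * ll_scale R n))); last first.
  by rewrite -mulrA; apply: ler_wpM2l; [lra|exact: lnll_le].
rewrite -mulrDr mulrC mulrA ler_wpM2r//.
by have := le_trans h3 h4; lra.
Qed.

Lemma prob_eventE (x : R) (n : nat) : 4 <= ll n ->
  prob_event P x n = avg n (P n) (fun m => (norm_omega n m <= x)%R%:R).
Proof.
move=> l4; have l0 : 0 < ll n by lra.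
have s0 : 0 < Num.sqrt (ll n) by rewrite sqrtr_gt0.
rewrite /prob_event big_mkcond /avg; apply: eq_bigr => m _.
rewrite /norm_omega /ll_scale ler_pdivrMr//.
by case: ifP => _; rewrite ?mulr1 ?mulr0.
Qed.

(** Markov's inequality in pointwise form: when the first step is 1 and the shifted one 0, [u] and
    [v] are more than [d] apart. *)
Lemma step_shift_le (u v x d : R) : 0 < d ->
  (u <= x)%R%:R <= (v <= x + d)%R%:R + d^-1 * `|u - v|.
Proof.
move=> d0; have n0 : 0 <= d^-1 * `|u - v| by rewrite mulr_ge0// invr_ge0 ltW.
have [ux|] := leP u x; last by rewrite addr_ge0.
have [vx|vx] := leP v (x + d); first by rewrite /= lerDl.
rewrite /= add0r mulrC ler_pdivlMr// mul1r.
by rewrite distrC; apply: le_trans (ler_norm _); lra.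
Qed.

Variable D : R.
Hypothesis Hiii : forall n : nat, 0 < ll n ->
  forall s : seq nat, distinct_primes s ->
  all (fun p : nat => p%:R <= alpha R n) s ->
  0 <= Ssum P n (\prod_(p <- s) p)%N <= D / n%:R.

(** The threshold moves twice by [d] on each side: once to replace [omega] by the count of small
    primes, once to compare with the truncated normal law. The Lipschitz bound then brings [x + 2 d]
    and [x - 2 d] back to [x]. *)
Lemma prob_event_cvg (x : R) : prob_event P x @ \oo --> gauss_cdf x.
Proof.
have [c c0 hc] := norm_omega_dev.
have gF := dev_gaussian_means HP Hiii.
have gG := gauss_gaussian_means R.
have pk0 := normal_peak_ge0 (1 : R).
apply/cvgrPdist_le => e e0.
pose k : R := normal_peak 1.
(* Chosen so that the two shifts change the normal distribution function by at most [e / 2]. *)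
pose d : R := e / (4 * (k + 1)).
have d0 : 0 < d by rewrite divr_gt0// mulr_gt0//; rewrite /k; lra.
have kd : k * (d + d) <= e / 2.
  have -> : e = d * (4 * (k + 1)) by rewrite /d divfK// gt_eqF// mulr_gt0//; rewrite /k; lra.
  rewrite -/k in pk0; nra.
(* At most three such errors are added to [e / 2]: comparison of means, Markov's inequality and, in
   the lower bound, truncation. *)
pose e4 := e / 8; have e40 : 0 < e4 by rewrite divr_gt0.
have up := gaussian_means_step_le (x + d) gF gG d0 e40.
have lo := gaussian_means_step_le (x - d - d) gG gF d0 e40.
have G1 : \forall n \near \oo, `|1 - gauss_int n.+1 (fun x => x ^+ 0)| <= e4.
  by have := gG.2 0%N => /cvgrPdist_le /(_ _ e40).
have gs : \forall n \near \oo, ll_small R n <= e4 * d / (c + 1).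
  have := @ll_small_cvg0 R => /cvgrPdist_le /(_ (e4 * d / (c + 1))).
  have p0 : 0 < e4 * d / (c + 1) by apply: divr_gt0; [exact: mulr_gt0|lra].
  move=> /(_ p0); apply: filterS => n; rewrite sub0r normrN; apply: le_trans.
  exact: ler_norm.
near=> n.
have l4 : 4 <= ll n by near: n; exact: loglog_ge_near.
have l0 : 0 < ll n by lra.
have [n1 n0] := loglog_gt0 l0.
have wp := @P_ge0 R P HP n.
have hup : dev_mean P n (fun y => (y <= x + d)%R%:R) <=
   gauss_int n.+1 (fun y => (y <= x + d + d)%R%:R) + e4 by near: n.
have hlo : gauss_int n.+1 (fun y => (y <= x - d - d)%R%:R) <=
   dev_mean P n (fun y => (y <= x - d - d + d)%R%:R) + e4 by near: n.
have hG : `|1 - gauss_int n.+1 (fun x => x ^+ 0)| <= e4 by near: n.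
have hs : ll_small R n <= e4 * d / (c + 1) by near: n.
pose Q := avg n (P n) (fun m => `|norm_omega n m - norm_dev R n m|).
have hQ : d^-1 * Q <= e4.
  rewrite mulrC ler_pdivrMr//; apply: (le_trans (hc n l4)).
  apply: (@le_trans _ _ ((c + 1) * ll_small R n)).
    have /andP[g0 _] := ll_small_itv l4.
    by rewrite ler_pM2r//; lra.
  by apply: (le_trans (ler_wpM2l _ hs)); rewrite 1?mulrC ?divfK// ?gt_eqF//; lra.
have a1 : prob_event P x n <= dev_mean P n (fun y => (y <= x + d)%R%:R) + d^-1 * Q.
  rewrite prob_eventE// -avgZ -avgD; apply: avg_le => // m _.
  exact: step_shift_le.
have a2 : dev_mean P n (fun y => (y <= x - d - d + d)%R%:R) <= prob_event P x n + d^-1 * Q.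
  rewrite prob_eventE// -avgZ -avgD; apply: avg_le => // m _.
  rewrite distrC subrK; have := step_shift_le (norm_dev R n m) (norm_omega n m) (x - d) d0.
  by rewrite subrK.
have b1 := gauss_int_step_le n.+1 (x + d + d).
have b2 := gauss_int_step_ge n.+1 (x - d - d).
have dd : 0 <= d + d by lra.
have b3 := gauss_cdf_lip x dd; rewrite addrA in b3.
have b4 := gauss_cdf_lip (x - d - d) dd.
have e3 : x - d - d + (d + d) = x by ring.
rewrite e3 in b4.
rewrite -/k in b3 b4.
move: hG; rewrite ler_norml => /andP[hG1 hG2].
have ee : e = 8 * e4 by rewrite /e4 mulrC divfK.
rewrite ee in kd.
rewrite ler_norml ee; apply/andP; split; lra.
Unshelve. all: by end_near. Qed.
End LargePrimes.

Theorem theorem2 (R : realType) (P : nat -> nat -> R)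
  (HP : forall n : nat, (1 <= n)%N -> is_distrib_on P n)
  (Hi : forall s : seq nat, distinct_primes s ->
          (fun n : nat => Ssum P n (\prod_(p <- s) p)%N) @ \oo --> 0)
  (Hii : exists C : R, forall n : nat, 0 < ln (ln (n%:R : R)) ->
          forall p : nat, prime p -> alpha R n < p%:R ->
          Ssum P n p <= C / p%:R)
  (Hiii : exists D : R, forall n : nat, 0 < ln (ln (n%:R : R)) ->
          forall s : seq nat, distinct_primes s ->
          all (fun p : nat => p%:R <= alpha R n) s ->
          0 <= Ssum P n (\prod_(p <- s) p)%N <= D / n%:R) :
  forall x : R,
    (fun n : nat => (prob_event P x n)%:E) @ \oo -->
      normal_prob (0 : R) 1 `]-oo, x].
Proof.
move=> x; have [C hC] := Hii; have [D hD] := Hiii.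
have -> : normal_prob (0 : R) 1 `]-oo, x] = (gauss_cdf x)%:E.
  by rewrite /gauss_cdf fineK// fin_num_measure.
apply: (cvg_comp (prob_event P x) EFin); first exact: (@prob_event_cvg R P HP C hC D hD x).
exact: cvg_id.
Qed.
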